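(* Let $n>2$ be an even integer and let $G$ be a group of order $2n$. Suppose that $G$ is one of the following: a dihedral group; a dicyclic group; an abelian group admitting a cyclic subgroup of index $2$ that is not a cyclic $2$-group; a non-cyclic $2$-group admitting a cyclic subgroup of index $2$. Then there exists a $G$-regular $1$-factorization of the complete graph $K_{2n}$ together with a complete set of rainbow spanning trees.
   Context: Identify the vertex set of $K_{2n}$ with the elements of $G$, with $G$ acting on vertices by right multiplication ($x\mapsto xg$), hence on edges by $[x,y]\cdot g=[xg,yg]$. A $1$-factorization of $K_{2n}$ is a partition of its edge set into $2n-1$ perfect matchings ($1$-factors). It is $G$-regular if $G$, acting in this way (sharply transitively on vertices), maps every $1$-factor of the factorization to a $1$-factor of the factorization. A rainbow spanning tree (with respect to the $1$-factorization) is a spanning tree of $K_{2n}$ having exactly one edge in each $1$-factor. A complete set of rainbow spanning trees is a set of rainbow spanning trees that partitions the edge set of $K_{2n}$ (so it consists of $n$ trees). A dicyclic group of order $4s$, $s\ge2$, is $\langle a,b: a^{2s}=1,\ b^2=a^s,\ b^{-1}ab=a^{-1}\rangle$. *)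

(* Defs.v *)
From mathcomp Require Import all_boot all_fingroup all_solvable.
Set Implicit Arguments. Unset Strict Implicit. Unset Printing Implicit Defensive.
Local Open Scope group_scope.

Section Graphs.
Variable gT : finGroupType.

Definition Kedges : {set {set gT}} := [set e : {set gT} | #|e| == 2%N].

Definition one_factor (M : {set {set gT}}) : bool :=
  (M \subset Kedges) && [forall x : gT, #|[set e in M | x \in e]| == 1%N].

Definition one_factorization (F : {set {set {set gT}}}) : bool :=
  [&& partition F Kedges, [forall M in F, one_factor M] & #|F| == (#|gT| - 1)%N].

Definition edge_rmul (e : {set gT}) (g : gT) : {set gT} := [set x * g | x in e].
Definition factor_rmul (M : {set {set gT}}) (g : gT) : {set {set gT}} :=
  [set edge_rmul e g | e in M].

(* G-regular, G = the whole group gT acting by right multiplication *)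
Definition regular_factorization (F : {set {set {set gT}}}) : bool :=
  [forall g : gT, forall M in F, factor_rmul M g \in F].

Definition adj (T : {set {set gT}}) : rel gT := fun x y => [set x; y] \in T.

Definition connectedE (T : {set {set gT}}) : Prop :=
  forall x y : gT, connect (adj T) x y.

Definition acyclicE (T : {set {set gT}}) : Prop :=
  ~ exists s : seq gT, [/\ (2 < size s)%N, uniq s & path.cycle (adj T) s].

Definition spanning_tree (T : {set {set gT}}) : Prop :=
  [/\ T \subset Kedges, connectedE T & acyclicE T].

Definition rainbow_spanning_tree (F : {set {set {set gT}}}) (T : {set {set gT}}) : Prop :=
  spanning_tree T /\ forall M, M \in F -> #|T :&: M| = 1%N.

Definition complete_rainbow_set (F : {set {set {set gT}}}) (Ts : {set {set {set gT}}}) : Prop :=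
  [/\ partition Ts Kedges, #|Ts| = (#|gT| %/ 2)%N &
      forall T, T \in Ts -> rainbow_spanning_tree F T].

End Graphs.

(* Main.v *)
Require Import Defs.
From mathcomp Require Import all_boot all_fingroup all_solvable.
From mathcomp Require Import zify.
Set Implicit Arguments. Unset Strict Implicit. Unset Printing Implicit Defensive.
Local Open Scope group_scope.

(* Let H be a cyclic subgroup of index 2, z its involution, which is central, y an element outside
   H, and H \ {1, z} the disjoint union of P and P^-1.  The 2n - 2 edges {1, p}, {y, yp},
   {1, y p^-1}, {y, p^-1} for p in P, {1, zy} and {z, zy} represent all the H-orbits of edges except
   the two orbits of edges {x, zx}, and they form a forest with two components, roughly the stars
   at 1 and at y.  The H-translates of this forest, each completed by a suitable edge {x, zx},
   decompose the complete graph into n spanning trees.  It is therefore enough to find a proper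
   edge colouring with 2n - 1 colours, permuted by right translations, for which the completed
   forest is rainbow.

   If some b outside H is an involution, or if y^2 = z, edges inside a coset of H are coloured,
   essentially, by the product of their endpoints, and most edges {x, dx} with x in H and d
   outside H by d.  All the groups of the theorem fall under these two cases, except the cyclic
   ones with 4 | n, for which the odd part m > 1 of n is used to repair the product colouring. *)

(** * Spanning trees *)

(** Apart from 1, only [z] among the elements of H fixes edges under right translation, and it fixes
    exactly the edges {x, zx}. Hence 2n - 2 orbits have length n, while the two exceptional ones,
    one in each coset of H, have length n/2 and together supply one completing edge for each of the
    n translates. Both kinds of completing edge must therefore carry the one colour that the forest
    misses. Counting replaces most direct verification: a connected graph with at most 2n - 1 edges
    is a tree, at most 2n - 1 edges that meet 2n - 1 colours meet each once, and n trees of at most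
    2n - 1 edges that cover n(2n - 1) edges are disjoint. The product x w is symmetric because H is
    abelian, and translation by h in H multiplies it by h^2. It leaves x^2 free at x, and edges
    leaving H must take this colour compatibly with the translations that exchange the cosets; this
    is where b^2 = 1 or y^2 = z enters. In a cyclic group of order 2n with 4 | n all elements of
    order 2 or 4 lie in H, so neither is available. *)

Section Trees.
Variable gT : finGroupType.
Implicit Types (T : {set {set gT}}) (x y : gT).

Lemma adj_sym T : symmetric (adj T).
Proof. by move=> x y; rewrite /adj setUC. Qed.

Lemma connected_adj_step T (A : {set gT}) x0 y0 :
  connectedE T -> x0 \in A -> y0 \notin A ->
  exists x y, [/\ x \in A, y \notin A & adj T x y].
Proof.
move=> conT x0A y0A.
case: (boolP [exists x in A, [exists y in ~: A, adj T x y]]).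
  case/exists_inP=> x xA /exists_inP[y]; rewrite inE => yA xy.
  by exists x, y.
move=> no; have clA : closed (adj T) (mem A).
  have imp x y : adj T x y -> x \in A -> y \in A.
    move=> xy xA; apply: contraR no => yA.
    by apply/exists_inP; exists x => //; apply/exists_inP; exists y; rewrite ?inE.
  move=> x y xy; apply/idP/idP; apply: imp => //.
  by rewrite adj_sym.
by move: y0A; rewrite -(closed_connect clA (conT x0 y0)) x0A.
Qed.

(** Connectedness lets a vertex set grow one vertex at a time, and each new vertex brings inside the
    set an edge that was not there before. *)
Lemma connected_card T : connectedE T -> (#|gT| <= #|T|.+1)%N.
Proof.
move=> conT.
have grow k : (k < #|gT|)%N -> exists A : {set gT},
    #|A| = k.+1 /\ (k <= #|[set e in T | e \subset A]|)%N.
  elim: k => [|k IHk] ltk; first by exists [set 1]; rewrite cards1.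
  have [A [cA cE]] := IHk (ltnW ltk).
  have [x0 x0A] : exists x, x \in A by apply/set0Pn; rewrite -card_gt0 cA.
  have [y0 y0A] : exists y, y \notin A.
    have /set0Pn[y] : ~: A != set0 by rewrite -card_gt0 cardsCs setCK cA subn_gt0.
    by rewrite inE => ?; exists y.
  have [x [y [xA yA xy]]] := connected_adj_step conT x0A y0A.
  exists (y |: A); rewrite cardsU1 yA cA; split=> //.
  have xyN : [set x; y] \notin [set e in T | e \subset A].
    by rewrite inE subUset !sub1set (negPf yA) !andbF.
  apply: (@leq_trans #|[set x; y] |: [set e in T | e \subset A]|).
    by rewrite cardsU1 xyN.
  apply: subset_leq_card; apply/subsetP=> e.
  case/setU1P=> [->|]; rewrite !inE.
    by rewrite subUset !sub1set !inE xA eqxx orbT /= andbT.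
  by case/andP=> -> /= eA; rewrite (subset_trans eA) // subsetUr.
have gT0 : (0 < #|gT|)%N by apply/card_gt0P; exists 1.
have [|A [_ cE]] := grow #|gT|.-1; first by rewrite prednK.
rewrite -(prednK gT0) ltnS (leq_trans cE) //.
by apply: subset_leq_card; apply/subsetP=> e; rewrite inE => /andP[].
Qed.

(** An edge of a cycle can be removed without losing connectedness, which would leave fewer edges
    than [connected_card] allows. *)
Lemma connected_acyclic T : connectedE T -> (#|T| < #|gT|)%N -> acyclicE T.
Proof.
move=> conT ltT [[|x [|y [|w s]]] [//= _]]; set s' := w :: s.
rewrite -[_ && uniq s]/(uniq s') => /and3P[].
rewrite inE negb_or => /andP[xy xs'] ys' us'.
rewrite -[_ && path _ _ _]/(path (adj T) y (rcons s' x)) => /andP[Txy].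
rewrite rcons_path => /andP[pys' Tlx].
pose T' := T :\ [set x; y].
have T'adj a b : adj T a b -> [set a; b] != [set x; y] -> adj T' a b.
  by rewrite /adj !inE => -> ->.
have py' : path (adj T') y s'.
  apply: (sub_in_path (P := predC1 x)) pys' => [a b /= ax bx ab|].
    apply: T'adj => //; apply: contraNneq ax => eq_ab.
    have : x \in [set a; b] by rewrite eq_ab !inE eqxx.
    by rewrite !inE ![x == _]eq_sym (negPf bx) orbF.
  apply/allP=> a; rewrite inE => /predU1P[->|as' /=]; first by rewrite /= eq_sym.
  by apply: contraNneq xs' => <-.
have lT' : adj T' (last y s') x.
  apply: T'adj => //; apply: contraNneq ys' => eq_l.
  have : y \in [set last y s'; x] by rewrite eq_l !inE eqxx orbT.
  rewrite !inE [y == x]eq_sym (negPf xy) orbF => /eqP yl.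
  by have := mem_last w s; rewrite -[last w s]/(last y s') -yl inE.
have cyx : connect (adj T') y x.
  by apply/connectP; exists (rcons s' x); rewrite ?last_rcons // rcons_path py'.
have symT' : connect_sym (adj T') by apply: sym_connect_sym; apply: adj_sym.
have conT' : connectedE T'.
  move=> a b; move: (conT a b); apply: connect_sub => {}a {}b ab.
  case: (eqVneq [set a; b] [set x; y]) => [eq_ab|]; last first.
    by move=> ne; apply/connect1/T'adj.
  have: a \in [set x; y] by rewrite -eq_ab !inE eqxx.
  have: b \in [set x; y] by rewrite -eq_ab !inE eqxx orbT.
  by rewrite !inE => /orP[] /eqP-> /orP[] /eqP->; rewrite ?connect0 // symT'.
have := connected_card conT'; rewrite leqNgt /T'.
by move: ltT; rewrite (cardsD1 [set x; y] T) -[_ \in T]/(adj T x y) Txy add1n => ->.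
Qed.

End Trees.

(** * One-factorizations from equivariant colourings *)

Section Coloring.
Variables (gT : finGroupType) (C : eqType) (c : gT -> gT -> C).

(** The action of translations on colours is left implicit: [rc_mul] says only that equality of
    colours is preserved. [rc_one] bounds the set of colours by those at the vertex 1, so that each
    colour class becomes a perfect matching. Loops have no meaningful colour, hence the conditions x
    != y. *)
Record regular_coloring : Prop := RegularColoring {
  rc_sym : forall x y, c x y = c y x;
  rc_inj : forall x y y', x != y -> x != y' -> c x y = c x y' -> y = y';
  rc_mul : forall g x y x' y', x != y -> x' != y' ->
    c x y = c x' y' -> c (x * g) (y * g) = c (x' * g) (y' * g);
  rc_one : forall x y, x != y -> exists2 w, w != 1 & c 1 w = c x y }.

Definition color_class (k : C) : {set {set gT}} :=
  [set e : {set gT} | [exists x, exists y, [&& x != y, e == [set x; y] & c x y == k]]].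

Definition color_classes : {set {set {set gT}}} :=
  [set color_class (c 1 w) | w in [set~ 1]].

Hypothesis cP : regular_coloring.

Lemma set2_inj (x y x' y' : gT) : [set x; y] = [set x'; y'] ->
  (x = x' /\ y = y') \/ (x = y' /\ y = x').
Proof.
move=> eq_e.
have xe : x \in [set x'; y'] by rewrite -eq_e set21.
have ye : y \in [set x'; y'] by rewrite -eq_e set22.
have x'e : x' \in [set x; y] by rewrite eq_e set21.
have y'e : y' \in [set x; y] by rewrite eq_e set22.
case/set2P: xe => ?; case/set2P: ye => ?; case/set2P: x'e => ?; case/set2P: y'e => ?.
all: solve [left; split; congruence | right; split; congruence].
Qed.

Lemma set2_Kedges (x y : gT) : ([set x; y] \in Kedges gT) = (x != y).
Proof. by rewrite inE cards2; case: (x != y). Qed.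

Lemma mem_color_class x y k : x != y -> ([set x; y] \in color_class k) = (c x y == k).
Proof.
move=> xy; rewrite inE; apply/existsP/idP => [[x' /existsP[y' /and3P[_ /eqP eq_e]]]|ck].
  by case: (set2_inj eq_e) => -[-> ->] //; rewrite (rc_sym cP).
by exists x; apply/existsP; exists y; rewrite xy eqxx.
Qed.

Lemma color_class_Kedges k : color_class k \subset Kedges gT.
Proof.
apply/subsetP=> e; rewrite [e \in color_class k]inE.
by case/existsP=> x /existsP[y /and3P[xy /eqP-> _]]; rewrite set2_Kedges.
Qed.

Lemma edgeP (e : {set gT}) : reflect (exists x y, x != y /\ e = [set x; y]) (e \in Kedges gT).
Proof.
by rewrite inE; apply: cards2P.
Qed.

(** The |G| - 1 distinct colours at x are all among the |G| - 1 colours at 1, so the two lists have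
    the same elements. *)
Lemma color_at x u v : u != v -> exists2 w, x != w & c x w = c u v.
Proof.
case/(rc_one cP)=> w0 w0n <-.
pose s x := [seq c x w | w <- enum [set~ x]].
have in_s z k : reflect (exists2 w, z != w & c z w = k) (k \in s z).
  apply: (iffP mapP) => [[w]|[w zw <-]].
    by rewrite mem_enum !inE eq_sym => zw ->; exists w.
  by exists w; rewrite // mem_enum !inE eq_sym.
have us : uniq (s x).
  rewrite map_inj_in_uniq ?enum_uniq // => w w'; rewrite !mem_enum !inE => wx w'x.
  by apply: (rc_inj cP); rewrite eq_sym.
have sub : {subset s x <= s 1}.
  move=> k /in_s[w xw <-]; apply/in_s.
  by have [w' w'1 <-] := rc_one cP xw; exists w'; rewrite // eq_sym.
have [|_ eq_s] := uniq_min_size us sub; first by rewrite !size_map -!cardE !cardsC1.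
by apply/in_s; rewrite eq_s; apply/in_s; exists w0; rewrite // eq_sym.
Qed.

Lemma mem_color_classes (u v : gT) : u != v -> color_class (c u v) \in color_classes.
Proof. by case/(rc_one cP)=> w w1 <-; apply: imset_f; rewrite !inE. Qed.

Lemma color_classesP M :
  reflect (exists2 w, w != 1 & M = color_class (c 1 w)) (M \in color_classes).
Proof.
apply: (iffP imsetP) => [[w w1 ->]|[w w1 ->]].
  by exists w; rewrite // !inE in w1 *.
by exists w; rewrite // !inE.
Qed.

Lemma color_class_inj u v u' v' : u != v ->
  color_class (c u v) = color_class (c u' v') -> c u v = c u' v'.
Proof.
move=> uv eqM; have : [set u; v] \in color_class (c u v) by rewrite mem_color_class.
by rewrite eqM mem_color_class // => /eqP.
Qed.

Lemma color_class_factor u v : u != v -> one_factor (color_class (c u v)).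
Proof.
move=> uv; rewrite /one_factor color_class_Kedges /=; apply/forallP=> x.
have [w xw cw] := color_at x uv.
apply/cards1P; exists [set x; w]; apply/setP=> e; rewrite in_set1 inE.
apply/andP/eqP => [[eM xe]|->]; last first.
  by rewrite mem_color_class // cw eqxx !inE eqxx.
have /edgeP[a [b [ab e_ab]]] := subsetP (color_class_Kedges _) e eM.
have [b' xb' e_xb]: exists2 b', x != b' & e = [set x; b'].
  move: xe; rewrite e_ab !inE => /orP[]/eqP->; first by exists b.
  by exists a; [rewrite eq_sym | rewrite setUC].
move: eM; rewrite e_xb mem_color_class // => /eqP cb.
by congr [set _; _]; apply: (rc_inj cP) xb' xw _; rewrite cb cw.
Qed.

Lemma card_color_classes : #|color_classes| = (#|gT| - 1)%N.
Proof.
rewrite card_in_imset ?cardsC1 ?subn1 // => w w'; rewrite !inE => w1 w'1.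
rewrite eq_sym in w1; rewrite eq_sym in w'1.
by move/(color_class_inj w1)/(rc_inj cP); apply.
Qed.

Lemma color_classes_partition : partition color_classes (Kedges gT).
Proof.
apply/and3P; split.
- rewrite eqEsubset; apply/andP; split.
    by apply/bigcupsP=> M /color_classesP[w _ ->]; apply: color_class_Kedges.
  apply/subsetP=> e /edgeP[x [y [xy ->]]]; apply/bigcupP.
  by exists (color_class (c x y)); rewrite ?mem_color_classes ?mem_color_class.
- apply/trivIsetP=> M M' /color_classesP[w w1 ->] /color_classesP[w' w'1 ->] neq.
  apply/pred0P=> e /=; apply/negP=> /andP[eM eM'].
  have /edgeP[a [b [ab e_ab]]] := subsetP (color_class_Kedges _) e eM.
  move: eM eM'; rewrite e_ab !mem_color_class // => /eqP cw /eqP cw'.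
  by rewrite -cw cw' eqxx in neq.
- apply/color_classesP=> -[w w1 M0].
  have : [set 1; w] \in set0 by rewrite M0 mem_color_class // eq_sym.
  by rewrite inE.
Qed.

Lemma color_classes_one_factorization : one_factorization color_classes.
Proof.
rewrite /one_factorization color_classes_partition card_color_classes eqxx andbT.
apply/forall_inP=> M /color_classesP[w w1 ->].
by apply: color_class_factor; rewrite eq_sym.
Qed.

Lemma edge_rmul2 x y g : edge_rmul [set x; y] g = [set x * g; y * g] :> {set gT}.
Proof. by rewrite /edge_rmul imsetU1 imset_set1. Qed.

Lemma edge_rmulK g : cancel (fun e : {set gT} => edge_rmul e g) (fun e => edge_rmul e g^-1).
Proof.
move=> e; rewrite /edge_rmul -imset_comp -[RHS]imset_id.
by apply: eq_imset => x /=; rewrite mulgK.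
Qed.

Lemma mem_factor_rmul (T : {set {set gT}}) x y g :
  ([set x * g; y * g] \in factor_rmul T g) = ([set x; y] \in T).
Proof. by rewrite -edge_rmul2; apply: (mem_imset _ _ (can_inj (edge_rmulK g))). Qed.

Lemma color_class_rmul u v g : u != v ->
  factor_rmul (color_class (c u v)) g = color_class (c (u * g) (v * g)).
Proof.
move=> uv; apply/setP=> e; apply/imsetP/idP => [[e' e'M ->]|eM].
  have /edgeP[a [b [ab e_ab]]] := subsetP (color_class_Kedges _) _ e'M.
  move: e'M; rewrite e_ab edge_rmul2 !mem_color_class ?(inj_eq (mulIg g)) // => /eqP cab.
  by apply/eqP; apply: (rc_mul cP).
have /edgeP[a [b [ab e_ab]]] := subsetP (color_class_Kedges _) _ eM.
exists [set a * g^-1; b * g^-1]; last by rewrite edge_rmul2 !mulgKV.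
move: eM; rewrite e_ab !mem_color_class ?(inj_eq (mulIg _)) // => /eqP cab.
have := rc_mul cP g^-1 ab _ cab; rewrite !mulgK => -> //.
by rewrite (inj_eq (mulIg g)).
Qed.

Lemma color_classes_regular : regular_factorization color_classes.
Proof.
apply/forallP=> g; apply/forall_inP=> M /color_classesP[w w1 ->].
rewrite color_class_rmul 1?eq_sym //.
by apply: mem_color_classes; rewrite (inj_eq (mulIg g)) eq_sym.
Qed.

End Coloring.

(** * Translates of a rainbow tree *)

Definition rainbow_decomposable (gT : finGroupType) : Prop :=
  exists F : {set {set {set gT}}},
    [/\ one_factorization F, regular_factorization F &
        exists Ts : {set {set {set gT}}}, complete_rainbow_set F Ts].

Section RainbowTrees.
Variables (gT : finGroupType) (C : eqType) (c : gT -> gT -> C).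
Variables (H : {group gT}) (z y : gT) (P : {set gT}).

Record tree_data : Prop := TreeData {
  td_yH : y \notin H;
  td_coset : forall g, g \notin H -> y^-1 * g \in H;
  td_zH : z \in H;
  td_z1 : z != 1;
  td_zz : z * z = 1;
  td_zC : forall g, z * g = g * z;
  td_PH : P \subset H;
  td_1P : 1 \notin P;
  td_zP : z \notin P;
  td_inv : forall h, h \in H -> h != 1 -> h != z -> (h^-1 \in P) = (h \notin P) }.

(** Each forest edge is indexed by its end v other than the two roots 1 and [y], where the function
    takes default values. A vertex of H other than 1 that reaches the branch with value [y] is the
    inverse of an element of P. *)
Definition tree_nbr (v : gT) : gT :=
  if v \in H then (if v \in P then 1 else if v == z then z * y else y)
  else (if y^-1 * v \in P then y else 1).

(** The component of 1 in the forest; [z] belongs to it through the path z, zy, 1. *)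
Definition root_side (v : gT) : bool :=
  if v \in H then [|| v == 1, v == z | v \in P] else (v != y) && (y^-1 * v \notin P).

Definition base_forest : {set {set gT}} := [set [set v; tree_nbr v] | v in ~: [set 1; y]].

Definition base_tree (u : gT) : {set {set gT}} := [set u; z * u] |: base_forest.

Hypotheses (cP : regular_coloring c) (dP : tree_data).

Let zV : z^-1 = z.
Proof. by apply/eqP; rewrite eq_sym eq_mulgV1 invgK (td_zz dP). Qed.

Let yz_y : y^-1 * (z * y) = z.
Proof. by rewrite (td_zC dP y) mulKg. Qed.

Lemma tree_nbr_neq v : v != 1 -> v != y -> v != tree_nbr v.
Proof.
move=> v1 vy; rewrite /tree_nbr; case: ifP => vH; last by case: ifP.
case: ifP => // _; case: (v =P z) => [->|_] //.
by rewrite eq_sym eq_mulgV1 (td_zC dP) mulgK; apply: contraNneq (td_yH dP) => ->.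
Qed.

Lemma mem_base_forest v : v != 1 -> v != y -> [set v; tree_nbr v] \in base_forest.
Proof. by move=> v1 vy; apply: imset_f; rewrite !inE negb_or v1. Qed.

Lemma card_base_tree u : (#|base_tree u| <= #|gT| - 1)%N.
Proof.
have y1 : 1 != y by apply: contraNneq (td_yH dP) => <-.
have gT2 : (1 < #|gT|)%N by rewrite (cardD1 1) (cardD1 y) !inE eq_sym y1.
rewrite (leq_trans (leq_of_leqif (leq_card_setU _ _))) // cards1 add1n.
rewrite (leq_ltn_trans (leq_imset_card _ _)) //.
by rewrite cardsCs setCK cards2 y1 ltn_sub2l.
Qed.

Lemma base_tree_Kedges u : base_tree u \subset Kedges gT.
Proof.
apply/subsetP=> e /setU1P[->|/imsetP[v + ->]]; rewrite set2_Kedges.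
  by rewrite eq_mulgV1 invMg mulgA mulgV mul1g zV (td_z1 dP).
by rewrite !inE negb_or => /andP[v1 vy]; apply: tree_nbr_neq.
Qed.

(** The forest joins every vertex to 1 or to [y] according to its side, and {u, zu} links the two
    components when its ends lie on different sides. *)
Lemma base_tree_connected u : root_side u != root_side (z * u) -> connectedE (base_tree u).
Proof.
set T := base_tree u => side.
have sym := sym_connect_sym (adj_sym T).
have nbr v : v != 1 -> v != y -> connect (adj T) v (tree_nbr v).
  by move=> v1 vy; apply/connect1/setU1r/mem_base_forest.
have yH := td_yH dP; have zyH : z * y \notin H by rewrite groupMl // (td_zH dP).
have zy_y : z * y != y.
  by rewrite eq_mulgV1 mulgK (td_z1 dP).
have c_zy : connect (adj T) (z * y) 1.
  have := nbr (z * y); rewrite /tree_nbr (negPf zyH) yz_y.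
  rewrite (negPf (td_zP dP)) => -> //.
  by apply: contraNneq zyH => ->.
have to_root v : root_side v -> connect (adj T) v 1.
  rewrite /root_side; case: ifP => vH.
    case: eqP => [->|/eqP v1]; first by rewrite connect0.
    have vy : v != y by apply: contraNneq yH => <-.
    have := nbr v v1 vy; rewrite /tree_nbr vH /=; case: ifP => // _; rewrite orbF.
    by case: ifP => // _ c_vzy _; apply: connect_trans c_vzy c_zy.
  case/andP=> vy vP; have := nbr v _ vy; rewrite /tree_nbr vH (negPf vP); apply.
  by apply: contraFneq vH => ->.
have to_y v : ~~ root_side v -> connect (adj T) v y.
  rewrite /root_side; case: ifP => vH.
    rewrite !negb_or => /and3P[v1 vz vP].
    have vy : v != y by apply: contraNneq yH => <-.
    by have := nbr v v1 vy; rewrite /tree_nbr vH (negPf vP) (negPf vz).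
  rewrite negb_and !negbK; case: eqP => [->|/eqP vy /= vP]; first by rewrite connect0.
  have := nbr v _ vy; rewrite /tree_nbr vH vP; apply.
  by apply: contraFneq vH => ->.
have c_u : connect (adj T) u (z * u) by apply/connect1/setU11.
have c_1y : connect (adj T) 1 y.
  case: (boolP (root_side u)) side => [su|su]; case: (boolP (root_side (z * u))) => // szu _.
    by rewrite (connect_trans _ (to_y _ szu)) // (connect_trans _ c_u) // sym to_root.
  by rewrite (connect_trans _ (to_y _ su)) // (connect_trans _ (etrans (sym _ _) c_u)) // sym to_root.
have c_1 v : connect (adj T) 1 v.
  rewrite sym; case: (boolP (root_side v)) => [|sv]; first exact: to_root.
  by rewrite (connect_trans (to_y _ sv)) // sym.
by move=> v w; rewrite (connect_trans _ (c_1 w)) // sym.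
Qed.

Lemma base_forest_orbit x x' : x != x' -> x' != z * x ->
  exists v h, [/\ v != 1, v != y, h \in H & [set x; x'] = [set v * h; tree_nbr v * h]].
Proof.
move=> xx' x'zx; have [yH zH] := (td_yH dP, td_zH dP).
have Hy h : h \in H -> y * h \notin H by move=> hH; rewrite groupMr.
have Hneq h : h \in H -> h != y by move=> hH; apply: contraNneq yH => <-.
have nbrH h : h \in H -> tree_nbr (y * h) = if h \in P then y else 1.
  by move=> hH; rewrite /tree_nbr (negPf (Hy h hH)) mulKg.
have cross k k' : k \in H -> k' \in H ->
    exists v h, [/\ v != 1, v != y, h \in H & [set k; y * k'] = [set v * h; tree_nbr v * h]].
  move=> kH k'H; have [w wH k'E] : exists2 w, w \in H & k' = w * k.
    by exists (k' * k^-1); rewrite ?mulgKV // groupM ?groupV.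
  have yw1 : y * w != 1 by apply: contraNneq (Hy w wH) => ->.
  (* The orbit of {1, y} is represented by {z, zy}, which z k moves to {k, y k}. *)
  case: (eqVneq w 1) => [w1|w1].
    exists z, (z * k); rewrite (td_z1 dP) Hneq ?groupM // /tree_nbr zH (negPf (td_zP dP)) eqxx.
    by rewrite k'E w1 mul1g !mulgA (td_zz dP) mul1g (td_zC dP y) -(mulgA y) (td_zz dP) mulg1.
  have ywy : y * w != y by rewrite -{2}[y]mulg1 (inj_eq (mulgI y)).
  case: (boolP (w \in P)) => wP; last first.
    exists (y * w), k; rewrite yw1 ywy kH nbrH // (negPf wP) mul1g.
    by rewrite k'E mulgA setUC.
  have wz : w != z by apply: contraTneq wP => ->; rewrite (td_zP dP).
  (* The edge {w^-1, y} moved by w k is {k, y w k}. *)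
  exists w^-1, (w * k); rewrite invg_eq1 w1 Hneq ?groupV ?groupM //.
  rewrite /tree_nbr groupV wH (td_inv dP) // wP /=.
  by rewrite -zV (inj_eq invg_inj) (negPf wz) mulKg k'E.
case: (boolP (x \in H)) => xH; case: (boolP (x' \in H)) => x'H.
- have [w wH x'E] : exists2 w, w \in H & x' = w * x.
    by exists (x' * x^-1); rewrite ?mulgKV // groupM ?groupV.
  have w1 : w != 1 by apply: contraNneq xx' => w1; rewrite x'E w1 mul1g.
  case: (boolP (w \in P)) => wP.
    by exists w, x; rewrite w1 Hneq // xH /tree_nbr wH wP mul1g -x'E setUC.
  have wz : w != z by apply: contraNneq x'zx => <-; rewrite x'E.
  exists w^-1, x'; rewrite invg_eq1 w1 Hneq ?groupV // x'H /tree_nbr groupV wH (td_inv dP) // wP.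
  by rewrite mul1g {2}x'E mulKg.
- by rewrite -[x'](mulKVg y); apply: cross => //; apply: (td_coset dP).
- by rewrite setUC -[x](mulKVg y); apply: cross => //; apply: (td_coset dP).
have [k kH xE] : exists2 k, k \in H & x = y * k.
  by exists (y^-1 * x); rewrite ?mulKVg ?(td_coset dP).
have [w wH x'E] : exists2 w, w \in H & x' = y * (w * k).
  by exists (y^-1 * x' * k^-1); rewrite ?mulgKV ?mulKVg // groupM ?groupV ?(td_coset dP).
have w1 : w != 1 by apply: contraNneq xx' => w1; rewrite x'E w1 mul1g xE.
have wz : w != z by apply: contraNneq x'zx => wz; rewrite x'E wz xE !mulgA (td_zC dP).
have ywy h : h != 1 -> y * h != y by move=> h1; rewrite -{2}[y]mulg1 (inj_eq (mulgI y)).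
have yw1 h : h \in H -> y * h != 1 by move=> hH; apply: contraNneq (Hy h hH) => ->.
case: (boolP (w \in P)) => wP.
  exists (y * w), k; rewrite yw1 // ywy // kH nbrH // wP.
  by rewrite -mulgA -xE -x'E setUC.
exists (y * w^-1), (w * k); rewrite yw1 ?groupV // ywy ?invg_eq1 // groupM // nbrH ?groupV //.
by rewrite (td_inv dP) // wP -mulgA mulKg -xE -x'E.
Qed.

Hypothesis H_index : #|gT| = (2 * #|H|)%N.

Section Rainbow.
Variable u : gT.
Hypothesis hit : forall w, w != 1 ->
  c u (z * u) = c 1 w \/ exists v, [/\ v != 1, v != y & c v (tree_nbr v) = c 1 w].

(** The sizes of the intersections with the |G| - 1 colour classes add up to at most |G| - 1, and
    each of them is positive. *)
Lemma base_tree_rainbow M : M \in color_classes c -> #|base_tree u :&: M| = 1%N.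
Proof.
set F := color_classes c; set T := base_tree u.
have uzu : u != z * u.
  by have := subsetP (base_tree_Kedges u) _ (setU11 _ _); rewrite set2_Kedges.
have hitM M' : M' \in F -> (1 <= #|T :&: M'|)%N.
  case/color_classesP=> w w1 ->; rewrite card_gt0; apply/set0Pn.
  have [cu|[v [v1 vy cv]]] := hit w1.
    by exists [set u; z * u]; rewrite inE setU11 mem_color_class ?cu ?eqxx.
  exists [set v; tree_nbr v]; rewrite in_setI mem_color_class ?tree_nbr_neq ?cv ?eqxx //.
  by rewrite andbT setU1r // mem_base_forest.
have sumT : (\sum_(M' in F) #|T :&: M'| = #|T|)%N.
  have /and3P[/eqP covF trivF _] := color_classes_partition cP.
  rewrite -sum1_card (eq_bigl (fun e => (e \in cover F) && (e \in T))).
    rewrite big_trivIset_cond //; apply: eq_bigr => M' _.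
    by rewrite -sum1_card; apply: eq_bigl => e; rewrite inE andbC.
  move=> e; rewrite covF; case: (boolP (e \in T)) => eT; rewrite ?andbF ?andbT //.
  by rewrite (subsetP (base_tree_Kedges u)).
move=> MF; apply/eqP; rewrite eqn_leq hitM // andbT -(leq_add2r (#|F| - 1)).
rewrite subnKC ?card_gt0; last by apply/set0Pn; exists M.
rewrite (card_color_classes cP) (leq_trans _ (card_base_tree u)) // -sumT (bigD1 M) //= leq_add2l.
rewrite -(card_color_classes cP) -/F (cardsD1 M) MF add1n subn1 /= -sum1_card.
rewrite (eq_bigl (fun M' => (M' \in F) && (M' != M))) => [|M']; last by rewrite !inE andbC.
by apply: leq_sum => M' /andP[/hitM].
Qed.

End Rainbow.

Lemma factor_rmulK g : cancel (fun M : {set {set gT}} => factor_rmul M g) (fun M => factor_rmul M g^-1).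
Proof.
move=> M; rewrite /factor_rmul -imset_comp -[RHS]imset_id.
by apply: eq_imset => e /=; rewrite edge_rmulK.
Qed.

(** Intersecting the translate of T by g with a factor M amounts to intersecting T with the
    translate of M by g^-1, which is again a factor. *)
Lemma rainbow_spanning_tree_rmul (T : {set {set gT}}) (g : gT) :
    T \subset Kedges gT -> connectedE T -> (#|T| < #|gT|)%N ->
    (forall M, M \in color_classes c -> #|T :&: M| = 1%N) ->
  rainbow_spanning_tree (color_classes c) (factor_rmul T g).
Proof.
move=> sTK conT ltT rbT.
have injg : injective (fun e : {set gT} => edge_rmul e g) := can_inj (edge_rmulK g).
have cardTg : #|factor_rmul T g| = #|T| by apply: card_imset.
have conTg : connectedE (factor_rmul T g).
  move=> x y'; rewrite -[x](mulgKV g) -[y'](mulgKV g).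
  have /connectP[p pp ->] := conT (x * g^-1) (y' * g^-1).
  elim: p (x * g^-1) pp => [|b p IHp] a /=; first by rewrite connect0.
  case/andP=> ab /IHp; apply: connect_trans; apply: connect1.
  by rewrite /adj mem_factor_rmul.
split.
  split=> //; last by apply: connected_acyclic; rewrite ?cardTg.
  apply/subsetP=> e /imsetP[e' /(subsetP sTK)/edgeP[a [b [ab ->]]] ->].
  by rewrite edge_rmul2 set2_Kedges (inj_eq (mulIg g)).
move=> M MF.
have M'F : factor_rmul M g^-1 \in color_classes c.
  by have /forallP/(_ g^-1)/forall_inP := color_classes_regular cP; apply.
rewrite -(rbT _ M'F) -(card_imset (T :&: _) injg) imsetI; last by move=> ? ? _ _; apply: injg.
have MK : factor_rmul (factor_rmul M g^-1) g = M.
  by have := factor_rmulK g^-1 M; rewrite invgK.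
by rewrite -[in LHS]MK.
Qed.

(* Each translate of the forest by an element of H receives one of the edges {x, zx}: in H if the
   translating element lies in a transversal R of {1, z}, outside H otherwise. *)
Lemma coloring_rainbow_decomposition u v :
    u \in H -> v \notin H ->
    root_side u != root_side (z * u) -> root_side v != root_side (z * v) ->
    c u (z * u) = c v (z * v) ->
    (forall w, w != 1 -> c u (z * u) = c 1 w \/
       exists t, [/\ t != 1, t != y & c t (tree_nbr t) = c 1 w]) ->
  rainbow_decomposable gT.
Proof.
move=> uH vH side_u side_v cuv hit_u; exists (color_classes c); split.
- exact: color_classes_one_factorization.
- exact: color_classes_regular.
have hit_v w : w != 1 -> c v (z * v) = c 1 w \/
       exists t, [/\ t != 1, t != y & c t (tree_nbr t) = c 1 w].
  by rewrite -cuv; apply: hit_u.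
have F1 : exists M, M \in color_classes c.
  have y1 : 1 != y by apply: contraNneq (td_yH dP) => <-.
  by exists (color_class c (c 1 y)); apply: mem_color_classes.
have gT1 : (0 < #|gT|)%N by apply/card_gt0P; exists 1.
have lt_tree w : (#|base_tree w| < #|gT|)%N.
  by rewrite (leq_ltn_trans (card_base_tree w)) // subn1 prednK.
(* Any total order on the group selects one element of each pair {h, zh}. *)
pose R := [set h in H | enum_rank h < enum_rank (z * h)].
have zH := td_zH dP.
have Rz h : h \in H -> (z * h \in R) = (h \notin R).
  move=> hH; rewrite !inE groupM // hH /= mulgA (td_zz dP) mul1g -leqNgt [in RHS]leq_eqVlt.
  rewrite (inj_eq (@ord_inj _)) (inj_eq enum_rank_inj).
  by rewrite eq_mulgV1 mulgK (negPf (td_z1 dP)).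
pose Ts := [set factor_rmul (base_tree u) h | h in R] :|:
           [set factor_rmul (base_tree v) h | h in H :\: R].
have treeTs T : T \in Ts -> rainbow_spanning_tree (color_classes c) T.
  case/setUP=> /imsetP[h _ ->].
    apply: rainbow_spanning_tree_rmul => //; first exact: base_tree_Kedges.
      exact: base_tree_connected.
    exact: base_tree_rainbow.
  apply: rainbow_spanning_tree_rmul => //; first exact: base_tree_Kedges.
    exact: base_tree_connected.
  exact: base_tree_rainbow.
have covTs : cover Ts = Kedges gT.
  apply/eqP; rewrite eqEsubset; apply/andP; split.
    by apply/bigcupsP=> T /treeTs[[]].
  have mem_u h e : h \in R -> e \in factor_rmul (base_tree u) h -> e \in cover Ts.
    by move=> hR eT; apply/bigcupP; exists (factor_rmul (base_tree u) h); rewrite // inE imset_f.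
  have mem_v h e : h \in H -> h \notin R -> e \in factor_rmul (base_tree v) h -> e \in cover Ts.
    move=> hH hR eT; apply/bigcupP; exists (factor_rmul (base_tree v) h); rewrite // inE orbC.
    by rewrite imset_f // inE hR.
  apply/subsetP=> e /edgeP[x [x' [xx' ->]]].
  have [x'E|x'zx] := eqVneq x' (z * x); last first.
    have [t [h [t1 ty hH ->]]] := base_forest_orbit xx' x'zx.
    have tT w : [set t; tree_nbr t] \in base_tree w by apply/setU1r/mem_base_forest.
    case: (boolP (h \in R)) => hR; first by apply: (mem_u h); rewrite // mem_factor_rmul.
    by apply: (mem_v h); rewrite // mem_factor_rmul.
  (* Since z is central, {x, zx} is the translate of {w, zw} both by h and by zh, and exactly one of
     these lies in R. *)
  have shift w h : w * h = x -> [set x; x'] = [set w * h; z * w * h] /\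
      [set x; x'] = [set w * (z * h); z * w * (z * h)].
    move=> whx; rewrite x'E -whx -!mulgA; split=> //.
    have -> : w * (z * h) = z * (w * h) by rewrite !mulgA (td_zC dP w).
    by rewrite (mulgA z z) (td_zz dP) mul1g setUC.
  case: (boolP (x \in H)) => xH.
    have hH : u^-1 * x \in H by rewrite groupM ?groupV.
    have [e1 e2] := shift u (u^-1 * x) (mulKVg _ _).
    case: (boolP (u^-1 * x \in R)) => hR.
      by apply: (mem_u _ _ hR); rewrite e1 mem_factor_rmul setU11.
    by apply: (mem_u (z * (u^-1 * x))); [rewrite Rz | rewrite e2 mem_factor_rmul setU11].
  have hH : v^-1 * x \in H.
    rewrite -(mulKVg y v) -(mulKVg y x) invMg -mulgA mulKg groupM ?groupV //; exact: (td_coset dP).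
  have [e1 e2] := shift v (v^-1 * x) (mulKVg _ _).
  case: (boolP (v^-1 * x \in R)) => hR; last first.
    by apply: (mem_v _ _ hH hR); rewrite e1 mem_factor_rmul setU11.
  by apply: (mem_v (z * (v^-1 * x)));
     [rewrite groupM | rewrite Rz // negbK | rewrite e2 mem_factor_rmul setU11].
have H0 : (0 < #|H|)%N by apply: cardG_gt0.
have cardTs : (#|Ts| <= #|H|)%N.
  rewrite (leq_trans (leq_of_leqif (leq_card_setU _ _))) //.
  rewrite (leq_trans (leq_add (leq_imset_card _ _) (leq_imset_card _ _))) //.
  by rewrite -[leqRHS](cardsID R H) leq_add2r subset_leq_card // subsetI subxx andbT;
     apply/subsetP=> h; rewrite inE => /andP[].
have leT T : T \in Ts -> (#|T| <= #|gT| - 1)%N.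
  by case/setUP=> /imsetP[h _ ->]; rewrite (leq_trans (leq_imset_card _ _)) // card_base_tree.
have sumTs : (\sum_(T in Ts) #|T| <= #|Ts| * (#|gT| - 1))%N.
  by rewrite -sum_nat_const leq_sum.
have cardK : #|Kedges gT| = (#|H| * (#|gT| - 1))%N.
  by rewrite card_draws bin2 H_index subn1 -mulnA [(2 * (_ * _))%N]mul2n doubleK.
have gT2 : (0 < #|gT| - 1)%N by rewrite H_index subn_gt0; case: #|H| H0 => // k _; rewrite mulnS.
have le1 : (#|cover Ts| <= \sum_(T in Ts) #|T|)%N by apply: leq_card_cover.
have le2 : (#|Ts| * (#|gT| - 1) <= #|H| * (#|gT| - 1))%N by rewrite leq_mul2r cardTs orbT.
(* The number of trees and their sizes are so far only bounded above. As the trees cover all |H|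
   (|G| - 1) edges, every bound is attained, which gives both disjointness and the number of
   trees. *)
exists Ts; split=> //.
  rewrite /partition covTs eqxx /=; apply/andP; split.
    rewrite /trivIset eqn_leq le1 andbT covTs cardK.
    exact: leq_trans sumTs le2.
  apply/negP=> /treeTs[_]; have [M MF] := F1; move/(_ M MF).
  by rewrite set0I cards0.
apply/eqP; rewrite H_index mulKn // eqn_leq cardTs /= -(leq_pmul2r gT2) -cardK -covTs.
exact: leq_trans le1 sumTs.
Qed.

End RainbowTrees.

(** * Product colourings *)

Section EquivariantColorings.
Variables (gT : finGroupType) (C : eqType) (c : gT -> gT -> C).

Definition color_shift (g : gT) : Prop := forall x y x' y', x != y -> x' != y' ->
  c x y = c x' y' -> c (x * g) (y * g) = c (x' * g) (y' * g).

Lemma color_shiftM g h : color_shift g -> color_shift h -> color_shift (g * h).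
Proof.
move=> sg sh x y x' y' xy x'y' eq_c; rewrite !mulgA.
by apply: sh; rewrite ?(inj_eq (mulIg g)) //; apply: sg.
Qed.

Lemma color_shift_map (f : C -> C) g :
  (forall x y, x != y -> c (x * g) (y * g) = f (c x y)) -> color_shift g.
Proof. by move=> fE x y x' y' xy x'y' eq_c; rewrite !fE // eq_c. Qed.

(** Translation by x^-1 carries a conflict at x to the vertex 1, so properness needs checking only
    there. *)
Lemma regular_coloring_from1 :
    (forall x y, c x y = c y x) -> (forall g, color_shift g) ->
    {in predC1 1 &, injective (c 1)} ->
    (forall x y, x != y -> exists2 w, w != 1 & c 1 w = c x y) ->
  regular_coloring c.
Proof.
move=> symc shc injc onec; split=> // x y y' xy xy'.
move/(shc x^-1 _ _ _ _ xy xy'); rewrite mulgV.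
have ne w : x != w -> w * x^-1 \in predC1 1 by rewrite inE -eq_mulgV1 eq_sym.
by move/(injc _ _ (ne _ xy) (ne _ xy'))/mulIg.
Qed.

End EquivariantColorings.

(** * Groups with a cyclic subgroup of index 2 *)

Section CyclicIndex2.
Variables (gT : finGroupType) (a : gT) (N : nat).
Hypotheses (N1 : (1 < N)%N) (oa : #[a] = N.*2) (card_gT : #|gT| = (2 * N.*2)%N).
Let H := <[a]>.
Let z := a ^+ N.

Definition half_powers : {set gT} := [set a ^+ (val i) | i in [pred i : 'I_N | 0 < i]].

Lemma expa_eq i j : (i < N.*2)%N -> (j < N.*2)%N -> (a ^+ i == a ^+ j) = (i == j).
Proof. by move=> i_lt j_lt; rewrite eq_expg_mod_order oa !modn_small. Qed.

Lemma mem_cycleE h : h \in H -> exists2 i, (i < N.*2)%N & h = a ^+ i.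
Proof. by case/cyclePmin=> i; rewrite oa => i_lt ->; exists i. Qed.

Lemma expa_mod : a ^+ N.*2 = 1.
Proof. by rewrite -oa expg_order. Qed.

Lemma mem_half_powers i : (i < N.*2)%N -> (a ^+ i \in half_powers) = (0 < i < N)%N.
Proof.
move=> i_lt; apply/imsetP/andP => [[j /= j0 /eqP]|[i0 iN]].
  by rewrite expa_eq => // [/eqP->|]; [split | have := ltn_ord j; lia].
by exists (Ordinal iN).
Qed.

Lemma index2_coset y g : y \notin H -> g \notin H -> y^-1 * g \in H.
Proof.
move=> yH gH.
have: H :|: y *: H = setT.
  apply/eqP; rewrite eqEcard subsetT cardsT card_gT cardsU card_lcoset -orderE oa.
  suff -> : H :&: y *: H = set0 by rewrite cards0; lia.
  apply/setP=> h; rewrite !inE mem_lcoset; apply: contraNF yH => /andP[hH yhH].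
  by rewrite -groupV -(mulgK h y^-1) groupM // groupV.
by move/setP/(_ g); rewrite !inE (negPf gH) mem_lcoset.
Qed.

(** H is normal, and a cyclic group has at most one involution, which conjugation must preserve. *)
Lemma involution_central g : z * g = g * z.
Proof.
have zH : z \in H by apply: mem_cycle.
have [gH|gH] := boolP (g \in H).
  by have [i _ ->] := mem_cycleE gH; rewrite -!expgD addnC.
have nH : <[a]> <| [set: gT].
  apply: index2_normal; first exact: subsetT.
  rewrite -divgS ?subsetT // cardsT card_gT -orderE oa mulnK //; lia.
have zgH : z ^ g \in H by rewrite memJ_norm // (subsetP (normal_norm nH)) ?inE.
have [i i_lt zgE] := mem_cycleE zgH.
have o_zg : (z ^ g) ^+ 2 = 1 by rewrite -conjXg -expgM muln2 expa_mod conj1g.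
have iE : (i == 0)%N || (i == N)%N.
  move/eqP: o_zg; rewrite zgE -expgM -[1](expg0 a) eq_expg_mod_order oa mod0n muln2.
  case: (ltnP i N) => iN.
    by rewrite modn_small ?ltn_double // double_eq0 => ->.
  rewrite -(subnK iN) doubleD modnDr modn_small ?ltn_double; lia.
have zg : z ^ g = z.
  case/orP: iE => /eqP i_eq; last by rewrite zgE i_eq.
  have /eqP : z = 1 by apply: (@conjg_inj _ g); rewrite conj1g zgE i_eq expg0.
  rewrite -(expg0 a) expa_eq; lia.
by rewrite -{2}zg /conjg mulKVg.
Qed.

Lemma index2_tree_data y : y \notin H -> tree_data <[a]> z y half_powers.
Proof.
move=> yH; split=> //.
- by move=> g; apply: index2_coset.
- exact: mem_cycle.
- by rewrite -(expg0 a) expa_eq; lia.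
- by rewrite -expgD addnn expa_mod.
- exact: involution_central.
- by apply/subsetP=> h /imsetP[i _ ->]; apply: mem_cycle.
- by rewrite -(expg0 a) mem_half_powers; lia.
- by rewrite mem_half_powers ?ltnn ?andbF; lia.
move=> h /mem_cycleE[i i_lt ->]; rewrite -(expg0 a) !expa_eq; try lia.
move=> i0 iN; have -> : (a ^+ i)^-1 = a ^+ (N.*2 - i).
  by apply/eqP; rewrite eq_invg_mul -expgD subnKC ?expa_mod // ltnW.
by rewrite !mem_half_powers //; lia.
Qed.

Lemma cycle_comm g h : g \in H -> h \in H -> g * h = h * g.
Proof. by move=> /mem_cycleE[i _ ->] /mem_cycleE[j _ ->]; rewrite -!expgD addnC. Qed.

Lemma involution_neq1 : z != 1.
Proof. by rewrite -(expg0 a) expa_eq; lia. Qed.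

Lemma involution_sq : z * z = 1.
Proof. by rewrite -expgD addnn expa_mod. Qed.

Lemma card_index2 : #|gT| = (2 * #|<[a]>|)%N.
Proof. by rewrite -orderE oa. Qed.

Lemma half_powers_opp h : h \in H -> h != 1 -> h != z -> h \notin half_powers ->
  z * h \in half_powers.
Proof.
case/mem_cycleE=> i i_lt ->; rewrite -(expg0 a) !expa_eq ?mem_half_powers //; try lia.
move=> i0 iN iP; have Ni : (N < i)%N by clear -i0 iN iP; lia.
have -> : z * a ^+ i = a ^+ (i - N).
  by rewrite -{1}(subnKC (ltnW Ni)) expgD mulgA involution_sq mul1g.
by rewrite mem_half_powers; clear -Ni i_lt; lia.
Qed.

Lemma color_shift_index2 (C : eqType) (c : gT -> gT -> C) y :
  y \notin H -> (forall h, h \in H -> color_shift c h) -> color_shift c y ->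
  forall g, color_shift c g.
Proof.
move=> yH sH sy g; have [gH|gH] := boolP (g \in H); first exact: sH.
by rewrite -(mulKVg y g); apply: color_shiftM => //; apply: sH; apply: index2_coset.
Qed.

(** * An element outside H whose square is the involution of H *)

Section Quaternion.
Variable y : gT.
Hypotheses (yH : y \notin H) (yy : y * y = z).

(* The edges {x, w} inside H get colour x w, which leaves x^2 and z x^2 free at x, the latter
   because {x, zx} gets its own colour; the edges {x, yx} and {x, y^-1 x} use up these two. *)
Definition quat_retract g := if g \in H then g else y^-1 * g.

(** The factor [z] outside H is forced by translation by [y]: the edge {x, yx} of colour x^2 goes to
    {ys, zs} with s = x^y, of colour z s^2. So a colour k in H must go to z k^y, and {x, w} inside H
    goes to {y x^y, y w^y}. *)
Definition quat_color x w :=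
  if (x \in H) == (w \in H) then
    (if w == z * x then y else (if x \in H then 1 else z) * (quat_retract x * quat_retract w))
  else if (w == y * x) || (w == y^-1 * x) then quat_retract x * quat_retract w
  else if x \in H then w * x^-1 else x * w^-1.

Let zH : z \in H. Proof. exact: mem_cycle. Qed.
Let zz := involution_sq.
Let zC := involution_central.
Let yV : y^-1 = z * y.
Proof. by apply: (mulgI y); rewrite mulgV mulgA -zC -mulgA yy zz. Qed.
Let yhH h : h \in H -> (y * h \in H) = false.
Proof. by move=> hH; rewrite groupMr // (negPf yH). Qed.
Let zyh h : y * (z * h) = z * (y * h).
Proof. by rewrite !mulgA zC. Qed.
Let zzh h : z * (z * h) = h.
Proof. by rewrite mulgA zz mul1g. Qed.
Let sideP g : g \in H \/ exists2 h, h \in H & g = y * h.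
Proof.
case: (boolP (g \in H)) => gH; [by left | right].
by exists (y^-1 * g); rewrite ?mulKVg // index2_coset.
Qed.

Lemma quat_color_sym x w : quat_color x w = quat_color w x.
Proof.
rewrite /quat_color [(w \in H) == _]eq_sym.
have zxw : (w == z * x) = (x == z * w).
  by rewrite -{1}[w]zzh (inj_eq (mulgI z)) eq_sym.
have yxw : (w == y * x) || (w == y^-1 * x) = (x == y * w) || (x == y^-1 * w).
  have shift g : (w == g * x) = (x == g^-1 * w).
    by rewrite eq_sym (can2_eq (mulKg g) (mulKVg g)).
  by rewrite !shift invgK orbC.
have rC : quat_retract x * quat_retract w = quat_retract w * quat_retract x.
  have rH g : quat_retract g \in H.
    by rewrite /quat_retract; case: (sideP g) => [gH|[h hH ->]]; rewrite ?gH // yhH // mulKg.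
  by rewrite cycle_comm.
by rewrite zxw yxw rC; case: (x \in H); case: (w \in H).
Qed.

Lemma quat_color_z x : quat_color x (z * x) = y.
Proof. by rewrite /quat_color groupMl // !eqxx. Qed.

Lemma quat_color_in x w : x \in H -> w \in H -> w != z * x -> quat_color x w = x * w.
Proof.
by move=> xH wH; rewrite /quat_color /quat_retract xH wH eqxx => /negPf->; rewrite mul1g.
Qed.

Lemma quat_color_out s t : s \in H -> t \in H -> t != z * s ->
  quat_color (y * s) (y * t) = z * (s * t).
Proof.
move=> sH tH ts; rewrite /quat_color /quat_retract !yhH // eqxx -zyh (inj_eq (mulgI y)).
by rewrite (negPf ts) !mulKg.
Qed.

Lemma quat_color_cross x t : x \in H -> t \in H ->
  quat_color x (y * t) = if (t == x) || (t == z * x) then x * t else y * t * x^-1.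
Proof.
move=> xH tH; have -> : quat_color x (y * t) = if (y * t == y * x) || (y * t == y * (z * x))
    then x * t else y * t * x^-1.
  by rewrite /quat_color /quat_retract xH !yhH // mulKg zyh yV -(mulgA z y x).
by rewrite !(inj_eq (mulgI y)).
Qed.

Lemma quat_color_shiftH h : h \in H -> color_shift quat_color h.
Proof.
(* Translation by h multiplies a product colour by h^2 and fixes the colours outside H, which are
   [y] and the differences w x^-1. *)
move=> hH; apply: (color_shift_map (f := fun k => if k \in H then k * (h * h) else k)).
have cross x t : x \in H -> t \in H -> quat_color (x * h) (y * t * h) =
    if quat_color x (y * t) \in H then quat_color x (y * t) * (h * h) else quat_color x (y * t).
  move=> xH tH; rewrite -mulgA !quat_color_cross ?groupM // mulgA !(inj_eq (mulIg h)).
  case: ifP => _; last by rewrite -!mulgA yhH ?groupM ?groupV // invMg mulKVg.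
  by rewrite groupM // -!mulgA (mulgA h) (cycle_comm hH tH) -!mulgA.
move=> x w xw; have [->|wzx] := eqVneq w (z * x).
  by rewrite -mulgA !quat_color_z (negPf yH).
case: (sideP x) (sideP w) wzx => [xH|[s sH ->]] [wH|[t tH ->]] wzx.
- rewrite !quat_color_in ?groupM // ?mulgA ?(inj_eq (mulIg h)) //.
  by rewrite -!mulgA (mulgA h) (cycle_comm hH wH) -!mulgA.
- exact: cross.
- by rewrite quat_color_sym [quat_color (y * s) _]quat_color_sym; apply: cross.
have ts : t != z * s by apply: contraNneq wzx => ->; rewrite zyh.
rewrite -!mulgA !quat_color_out ?groupM // ?mulgA ?(inj_eq (mulIg h)) //.
by rewrite -!mulgA (mulgA h) (cycle_comm hH tH) -!mulgA.
Qed.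

Lemma quat_color_shifty : color_shift quat_color y.
Proof.
(* The translation exchanges the cosets, so a difference taken from the end in H to the end outside
   is inverted; the colour [y] of the edges {x, zx} is fixed. *)
pose f (k : gT) : gT := if k \in H then z * k ^ y else if k == y then y else k^-1.
have JH h : h \in H -> h ^ y \in H.
  by move=> hH; rewrite /conjg index2_coset // groupMl.
have zJ : z ^ y = z by rewrite /conjg zC mulKg.
have Hy h : h * y = y * h ^ y by rewrite /conjg mulKVg.
have yHy h : y * h * y = z * h ^ y by rewrite -mulgA Hy mulgA yy.
have cross x t : x \in H -> t \in H ->
    quat_color (x * y) (y * t * y) = f (quat_color x (y * t)).
  move=> xH tH; rewrite (Hy x) yHy quat_color_sym !quat_color_cross ?JH ?(groupM zH) ?JH //.
  have -> : (x ^ y == z * t ^ y) || (x ^ y == z * (z * t ^ y)) = (t == x) || (t == z * x).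
    have -> : (x ^ y == z * t ^ y) = (t == z * x).
      by rewrite -{1}zJ -conjMg (inj_eq (@conjg_inj _ y)) -{1}[x]zzh (inj_eq (mulgI z)) eq_sym.
    by rewrite zzh (inj_eq (@conjg_inj _ y)) orbC [x == t]eq_sym.
  case: ifP => [_|/norP[tx tzx]].
    by rewrite /f groupM // conjMg -mulgA (cycle_comm (JH _ tH) (JH _ xH)).
  have txH : t * x^-1 \in H by rewrite groupM ?groupV.
  rewrite /f -(mulgA y t) yhH // -[X in _ == X]mulg1 (inj_eq (mulgI y)) -eq_mulgV1 (negPf tx).
  have zV : z^-1 = z by apply: (mulgI z); rewrite mulgV zz.
  have -> : (y * (t * x^-1))^-1 = x * t^-1 * (z * y) by rewrite invMg [(t * _)^-1]invMg invgK yV.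
  have -> : (z * t ^ y)^-1 = t^-1 ^ y * z by rewrite invMg zV conjVg.
  by rewrite (mulgA (y * _)) -(mulgA y) -conjMg -Hy -!mulgA zC.
apply: (color_shift_map (f := f)).
move=> x w xw; have [->|wzx] := eqVneq w (z * x).
  by rewrite -mulgA !quat_color_z /f (negPf yH) eqxx.
case: (sideP x) (sideP w) wzx => [xH|[s sH ->]] [wH|[t tH ->]] wzx.
- rewrite !Hy (quat_color_in xH wH wzx) /f groupM // conjMg quat_color_out ?JH //.
  by rewrite -{1}zJ -conjMg (inj_eq (@conjg_inj _ y)).
- exact: cross.
- by rewrite quat_color_sym [quat_color (y * s) _]quat_color_sym; apply: cross.
have ts : t != z * s by apply: contraNneq wzx => ->; rewrite zyh.
have zHJ h : h \in H -> z * h ^ y \in H by move=> hH; rewrite groupM ?JH.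
have ts' : z * t ^ y != z * (z * s ^ y).
  by rewrite (inj_eq (mulgI z)) -{1}zJ -conjMg (inj_eq (@conjg_inj _ y)).
rewrite !yHy (quat_color_in (zHJ s sH) (zHJ t tH) ts') quat_color_out // /f groupM ?groupM //.
by rewrite !conjMg zJ (mulgA _ z) -(zC (z * s ^ y)) -!(mulgA z).
Qed.

(** The colours at 1 are all group elements except y^-1: the edges to [y] and zy have colours 1 and
    [z], and the edge to [z] has colour [y]. *)
Lemma quat_color_regular : regular_coloring quat_color.
Proof.
have c1H w : w \in H -> quat_color 1 w = if w == z then y else w.
  move=> wH; have [->|wz] := eqVneq w z; first by have := quat_color_z 1; rewrite mulg1.
  by rewrite quat_color_in ?mulg1 ?mul1g.
have c1y t : t \in H -> quat_color 1 (y * t) = if (t == 1) || (t == z) then t else y * t.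
  by move=> tH; rewrite quat_color_cross // invg1 !mulg1 mul1g.
have Hy h : h \in H -> h != y by move=> hH; apply: contraNneq yH => <-.
have yt_y t : (y == y * t) = (t == 1) by rewrite -{1}[y]mulg1 (inj_eq (mulgI y)) eq_sym.
have Hyt h t : h \in H -> t \in H -> (h == y * t) = false.
  by move=> hH tH; apply/negP=> /eqP h_yt; move: (yhH tH); rewrite -h_yt hH.
apply: regular_coloring_from1.
- exact: quat_color_sym.
- exact: (color_shift_index2 yH quat_color_shiftH quat_color_shifty).
- move=> w w'; rewrite !inE; case: (sideP w) => [wH|[t tH ->]]; case: (sideP w') => [w'H|[t' t'H ->]].
  + rewrite !c1H //; case: (eqVneq w z) => [->|_]; case: (eqVneq w' z) => [->|_] _ _ //.
      by move/eqP; rewrite eq_sym (negPf (Hy _ w'H)).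
    by move/eqP; rewrite (negPf (Hy _ wH)).
  + rewrite c1H // c1y //; case: (eqVneq w z) => [->|wz] w1 _.
      case: ifP => [/orP[]/eqP-> /eqP|/norP[t1 _] /eqP]; rewrite ?yt_y ?(negPf t1) //.
        by rewrite eq_sym (negPf (Hy _ _)).
      by rewrite eq_sym (negPf (Hy _ _)).
    case: ifP => [/orP[]/eqP-> /eqP|_ /eqP]; rewrite ?(negPf w1) ?(negPf wz) //.
    by rewrite Hyt.
  + rewrite (c1H w') // c1y //; case: (eqVneq w' z) => [->|wz] _ w1.
      case: ifP => [/orP[]/eqP-> /eqP|/norP[t1 _] /eqP]; rewrite 1?eq_sym ?yt_y ?(negPf t1) //.
        by rewrite eq_sym (negPf (Hy _ _)).
      by rewrite eq_sym (negPf (Hy _ _)).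
    case: ifP => [/orP[]/eqP-> /eqP|_ /eqP]; rewrite 1?eq_sym ?(negPf w1) ?(negPf wz) //.
    by rewrite Hyt.
  rewrite !c1y // => _ _; case: ifP => _; case: ifP => _ //; try by move->.
    by move/eqP; rewrite Hyt.
  by move/eqP; rewrite eq_sym Hyt.
have one k : k \in H \/ k = y \/ (exists2 h, h \in H & (h != 1) && (h != z) /\ k = y * h) ->
    exists2 w, w != 1 & quat_color 1 w = k.
  case=> [kH|[->|[h hH [/andP[h1 hz] ->]]]].
  - have [k1z|/norP[k1 kz]] := boolP ((k == 1) || (k == z)).
      exists (y * k); last by rewrite c1y // k1z.
      by apply: contraFneq (yhH kH) => ->.
    by exists k; rewrite // c1H // (negPf kz).
  - by exists z; rewrite ?involution_neq1 // c1H // eqxx.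
  exists (y * h); first by apply: contraFneq (yhH hH) => ->.
  by rewrite c1y // (negPf h1) (negPf hz).
have cross x t : x \in H -> t \in H -> exists2 w, w != 1 & quat_color 1 w = quat_color x (y * t).
  move=> xH tH; apply: one; rewrite quat_color_cross //.
  case: ifP => [_|/norP[tx tzx]]; first by left; rewrite groupM.
  right; right; exists (t * x^-1); rewrite ?groupM ?groupV // mulgA; split=> //.
  rewrite -eq_mulgV1 tx; apply: contraNneq tzx => <-.
  by rewrite mulgKV.
move=> x w xw; have [->|wzx] := eqVneq w (z * x).
  by apply: one; right; left; rewrite quat_color_z.
case: (sideP x) (sideP w) wzx => [xH|[s sH ->]] [wH|[t tH ->]] wzx.
- by apply: one; left; rewrite quat_color_in // groupM.
- exact: cross.
- by rewrite quat_color_sym; apply: cross.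
have ts : t != z * s by apply: contraNneq wzx => ->; rewrite zyh.
by apply: one; left; rewrite quat_color_out // !groupM.
Qed.

(** The edges {1, p} have colours p and the edges {y, yp} colours zp, which together exhaust H
    without 1 and [z]; {z, zy} and {1, zy} have colours 1 and [z]. The other forest edges have the
    colours yh for h in H different from 1 and [z], and the completing edge has colour [y]. *)
Lemma quaternion_rainbow : rainbow_decomposable gT.
Proof.
pose P := half_powers.
have dP : tree_data <[a]> z y P by apply: index2_tree_data.
have aH : a \in H by apply: cycle_id.
have aP : a \in P by rewrite -[a]expg1 mem_half_powers; lia.
have zaP : z * a \notin P by rewrite -expgSr mem_half_powers; lia.
have za1 : z * a != 1 by rewrite -expgSr -(expg0 a) expa_eq; lia.
have za_z : z * a != z by rewrite -expgSr expa_eq; lia.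
have zyy : z * y != y by rewrite eq_mulgV1 mulgK involution_neq1.
apply: (coloring_rainbow_decomposition quat_color_regular dP card_index2 aH yH).
- by rewrite /root_side aH groupM // aP (negPf zaP) (negPf za1) (negPf za_z) !orbT.
- rewrite /root_side (negPf yH) eqxx zC yhH // mulKg (td_zP dP) andbT.
  by rewrite -zC zyy.
- by rewrite !quat_color_z.
have y1 h : h \in H -> y * h != 1 by move=> hH; apply: contraFneq (yhH hH) => ->.
have ny h : h \in H -> h != y by move=> hH; apply: contraNneq yH => <-.
have Hyk k h : k \in H -> h \in H -> (y * h == k) = false.
  by move=> kH hH; apply/negP=> /eqP ykh; move: (yhH hH); rewrite ykh kH.
have nyh h : h != 1 -> y * h != y by move=> h1; rewrite -[X in _ != X]mulg1 (inj_eq (mulgI y)).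
move=> w w1; rewrite quat_color_z; case: (sideP w) => [wH|[t tH w_yt]].
  have [->|wz] := eqVneq w z; first by left; have := quat_color_z 1; rewrite mulg1.
  right; rewrite quat_color_in ?mulg1 // mul1g; case: (boolP (w \in P)) => wP.
    exists w; rewrite w1 ny // /tree_nbr wH wP quat_color_in ?mulg1 // eq_sym.
    by apply: contraNneq wz => zw1; rewrite -[w]zzh zw1 mulg1.
  have zwP : z * w \in P by apply: half_powers_opp.
  exists (y * (z * w)); rewrite y1 ?groupM // nyh; last first.
    by apply: contraNneq wz => zw1; rewrite -[w]zzh zw1 mulg1.
  rewrite /tree_nbr yhH ?groupM // mulKg zwP -[X in quat_color _ X]mulg1.
  by rewrite quat_color_out ?groupM ?mulg1 ?zzh // eq_sym.
have [t1|t1] := eqVneq t 1.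
  have zy_z : z * y != z by rewrite -[X in _ != X]mulg1 (inj_eq (mulgI z)) eq_sym ny.
  right; exists z; rewrite involution_neq1 // ny // /tree_nbr zH (negPf (td_zP dP)) eqxx.
  by rewrite w_yt t1 zC !quat_color_cross // !eqxx /= zz mulg1.
have [tz|tz] := eqVneq t z.
  right; exists (z * y); rewrite zC y1 // nyh ?involution_neq1 // /tree_nbr yhH // mulKg.
  by rewrite (negPf (td_zP dP)) quat_color_sym w_yt tz.
have -> : quat_color 1 w = y * t.
  by rewrite w_yt quat_color_cross // (negPf t1) mulg1 (negPf tz) invg1 mulg1.
right; case: (boolP (t \in P)) => tP; last first.
  exists (y * t); rewrite y1 // nyh // /tree_nbr yhH // mulKg (negPf tP) quat_color_sym.
  by rewrite quat_color_cross // (negPf t1) mulg1 (negPf tz) invg1 mulg1.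
have tVP : t^-1 \notin P by rewrite (td_inv dP) // tP.
have zV : z^-1 = z by apply: (mulgI z); rewrite mulgV zz.
have tVz : t^-1 != z by rewrite -zV (inj_eq invg_inj).
exists t^-1; rewrite invg_eq1 t1 ny ?groupV // /tree_nbr groupV tH (negPf tVP) (negPf tVz).
rewrite -[X in quat_color _ X]mulg1 quat_color_cross ?groupV // invgK mulg1 eq_sym invg_eq1 (negPf t1).
have -> : (1 == z * t^-1) = (t == z) by rewrite eq_sym -eq_mulgV1 eq_sym.
by rewrite (negPf tz) mulg1.
Qed.

End Quaternion.

(** * An involution outside H *)

Section Split.
Variable b : gT.
Hypotheses (bH : b \notin H) (bb : b * b = 1).

(* The product colouring of the edges inside the cosets of H misses only x^2 at a vertex x of H,
   which is the colour of {x, bx}. *)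
Definition split_retract g := if g \in H then g else b * g.

Definition split_color x w :=
  if ((x \in H) == (w \in H)) || (w == b * x) then split_retract x * split_retract w
  else if x \in H then w * x^-1 else x * w^-1.

Let zH : z \in H. Proof. exact: mem_cycle. Qed.
Let zz := involution_sq.
Let zC := involution_central.
Let bV : b^-1 = b. Proof. by apply: (mulgI b); rewrite mulgV bb. Qed.
Let bhH h : h \in H -> (b * h \in H) = false.
Proof. by move=> hH; rewrite groupMr // (negPf bH). Qed.
Let bbh h : b * (b * h) = h. Proof. by rewrite mulgA bb mul1g. Qed.
Let zbh h : b * (z * h) = z * (b * h).
Proof. by rewrite !mulgA zC. Qed.
Let zzh h : z * (z * h) = h.
Proof. by rewrite mulgA zz mul1g. Qed.
Let sideP g : g \in H \/ exists2 h, h \in H & g = b * h.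
Proof.
case: (boolP (g \in H)) => gH; [by left | right].
by exists (b^-1 * g); rewrite ?mulKVg // index2_coset.
Qed.

Lemma split_color_sym x w : split_color x w = split_color w x.
Proof.
rewrite /split_color [(w \in H) == _]eq_sym.
have -> : (w == b * x) = (x == b * w) by rewrite -{1}[w]bbh (inj_eq (mulgI b)) eq_sym.
have rC : split_retract x * split_retract w = split_retract w * split_retract x.
  have rH g : split_retract g \in H.
    by rewrite /split_retract; case: (sideP g) => [gH|[h hH ->]]; rewrite ?gH // bhH // bbh.
  by rewrite cycle_comm.
by rewrite rC; case: (x \in H); case: (w \in H).
Qed.

Lemma split_color_in x w : x \in H -> w \in H -> split_color x w = x * w.
Proof. by move=> xH wH; rewrite /split_color /split_retract xH wH eqxx. Qed.

Lemma split_color_out s t : s \in H -> t \in H -> split_color (b * s) (b * t) = s * t.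
Proof. by move=> sH tH; rewrite /split_color /split_retract !bhH // eqxx !bbh. Qed.

Lemma split_color_cross x t : x \in H -> t \in H ->
  split_color x (b * t) = if t == x then x * t else b * t * x^-1.
Proof.
by move=> xH tH; rewrite /split_color /split_retract xH !bhH //= bbh (inj_eq (mulgI b)).
Qed.

Lemma split_color_shiftH h : h \in H -> color_shift split_color h.
Proof.
move=> hH; apply: (color_shift_map (f := fun k => if k \in H then k * (h * h) else k)).
have mulh s t : t \in H -> s * h * (t * h) = s * t * (h * h).
  by move=> tH; rewrite -!mulgA (mulgA h) (cycle_comm hH tH) -!mulgA.
have cross x t : x \in H -> t \in H -> split_color (x * h) (b * t * h) =
    if split_color x (b * t) \in H then split_color x (b * t) * (h * h) else split_color x (b * t).
  move=> xH tH; rewrite -mulgA !split_color_cross ?groupM // (inj_eq (mulIg h)).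
  case: ifP => _; first by rewrite groupM // mulh.
  by rewrite -!mulgA bhH ?groupM ?groupV // invMg mulKVg.
move=> x w xw; case: (sideP x) (sideP w) => [xH|[s sH ->]] [wH|[t tH ->]].
- by rewrite !split_color_in ?groupM // mulh.
- exact: cross.
- by rewrite split_color_sym [split_color (b * s) _]split_color_sym; apply: cross.
by rewrite -!mulgA !split_color_out ?groupM // -mulh // -!mulgA.
Qed.

Lemma split_color_shiftb : color_shift split_color b.
Proof.
pose f (k : gT) : gT := if k \in H then k ^ b else k^-1.
have JH h : h \in H -> h ^ b \in H.
  by move=> hH; rewrite /conjg index2_coset // groupMl.
have Hb h : h * b = b * h ^ b by rewrite /conjg mulKVg.
have bHb h : b * h * b = h ^ b by rewrite -mulgA Hb bbh.
have cross x t : x \in H -> t \in H ->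
    split_color (x * b) (b * t * b) = f (split_color x (b * t)).
  move=> xH tH; rewrite (Hb x) bHb split_color_sym !split_color_cross ?JH //.
  rewrite (inj_eq (@conjg_inj _ b)) [x == t]eq_sym.
  case: ifP => [_|tx]; first by rewrite /f groupM // conjMg (cycle_comm (JH _ tH) (JH _ xH)).
  have txH : t * x^-1 \in H by rewrite groupM ?groupV.
  rewrite /f -(mulgA b t) bhH // -conjVg -(mulgA b) -conjMg -Hb.
  by rewrite invMg [(t * _)^-1]invMg invgK bV.
apply: (color_shift_map (f := f)).
move=> x w xw; case: (sideP x) (sideP w) => [xH|[s sH ->]] [wH|[t tH ->]].
- by rewrite !Hb (split_color_in xH wH) /f groupM // conjMg split_color_out ?JH.
- exact: cross.
- by rewrite split_color_sym [split_color (b * s) _]split_color_sym; apply: cross.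
by rewrite !bHb (split_color_in (JH s sH) (JH t tH)) split_color_out // /f groupM // conjMg.
Qed.

(** Here [b] is the only group element that is not a colour: {1, b} has colour 1, and any other edge
    {1, w} has colour w. *)
Lemma split_color_regular : regular_coloring split_color.
Proof.
have c1H w : w \in H -> split_color 1 w = w by move=> wH; rewrite split_color_in ?mul1g.
have c1b t : t \in H -> split_color 1 (b * t) = if t == 1 then t else b * t.
  by move=> tH; rewrite split_color_cross // invg1 mulg1 mul1g.
have bh1 h : h \in H -> b * h != 1 by move=> hH; apply: contraFneq (bhH hH) => ->.
have Hbt h t : h \in H -> t \in H -> (h == b * t) = false.
  by move=> hH tH; apply/negP=> /eqP h_bt; move: (bhH tH); rewrite -h_bt hH.
apply: regular_coloring_from1.
- exact: split_color_sym.
- exact: (color_shift_index2 bH split_color_shiftH split_color_shiftb).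
- move=> w w'; rewrite !inE; case: (sideP w) => [wH|[t tH ->]]; case: (sideP w') => [w'H|[t' t'H ->]].
  + by rewrite !c1H.
  + rewrite c1H // c1b //; case: (eqVneq t' 1) => [->|_] w1 _ /eqP; first by rewrite (negPf w1).
    by rewrite Hbt.
  + rewrite (c1H w') // c1b //; case: (eqVneq t 1) => [->|_] _ w'1 /eqP; rewrite eq_sym ?(negPf w'1) //.
    by rewrite Hbt.
  rewrite !c1b //; case: (eqVneq t 1) => [->|_]; case: (eqVneq t' 1) => [->|_] _ _ // /eqP; first by rewrite Hbt.
  by rewrite eq_sym Hbt.
have one k : k \in H \/ (exists2 h, h \in H & h != 1 /\ k = b * h) ->
    exists2 w, w != 1 & split_color 1 w = k.
  case=> [kH|[h hH [h1 ->]]]; last by exists (b * h); rewrite ?bh1 // c1b // (negPf h1).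
  have [->|k1] := eqVneq k 1; last by exists k; rewrite ?c1H.
  by exists (b * 1); rewrite ?bh1 // c1b // eqxx.
have cross x t : x \in H -> t \in H -> exists2 w, w != 1 & split_color 1 w = split_color x (b * t).
  move=> xH tH; apply: one; rewrite split_color_cross //.
  have [_|tx] := eqVneq t x; first by left; rewrite groupM.
  by right; exists (t * x^-1); rewrite ?groupM ?groupV // mulgA -eq_mulgV1.
move=> x w xw; case: (sideP x) (sideP w) => [xH|[s sH ->]] [wH|[t tH ->]].
- by apply: one; left; rewrite split_color_in // groupM.
- exact: cross.
- by rewrite split_color_sym; apply: cross.
by apply: one; left; rewrite split_color_out // !groupM.
Qed.

(* The tree is built on y = b t: with t = 1 the edges {1, p} and {y, yp} would share a colour. *)
Lemma split_rainbow_twist t (P := half_powers) :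
    t \in H -> t != 1 -> t != z -> (t \in P) != (z * t \in P) ->
    1 = z * t * t \/ t \in P ->
    (forall k, k \in H -> k != 1 -> [\/ k = z * t * t, k \in P,
       exists2 p, p \in P & k = t * p * t | t^-1 \in P /\ k = t * t]) ->
  rainbow_decomposable gT.
Proof.
move=> tH t1 tz side_t hit1 hitH; pose y := b * t.
have yH : y \notin H by rewrite bhH.
have dP : tree_data <[a]> z y P by apply: index2_tree_data.
have zt1 : z * t != 1 by apply: contraNneq tz => zt1; rewrite -[t]zzh zt1 mulg1.
have ztz : z * t != z by rewrite -[X in _ != X]mulg1 (inj_eq (mulgI z)).
have zyy : z * y != y by rewrite eq_mulgV1 mulgK involution_neq1.
have PH p : p \in P -> p \in H := subsetP (td_PH dP) p.
have bh1 h : h \in H -> b * h != 1 by move=> hH; apply: contraFneq (bhH hH) => ->.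
have ny h : h \in H -> h != y by move=> hH; apply: contraNneq yH => <-.
have nbrH w : w \in H -> tree_nbr <[a]> z y P (y * w) = if w \in P then y else 1.
  move=> wH; have ywH : (y * w \in H) = false by rewrite groupMr // (negPf yH).
  by rewrite /tree_nbr ywH mulKg.
have nyw w : w != 1 -> y * w != y by move=> w1; rewrite -[X in _ != X]mulg1 (inj_eq (mulgI y)).
have c_t : split_color t (z * t) = z * t * t.
  by rewrite split_color_in ?groupM // mulgA -zC.
apply: (coloring_rainbow_decomposition split_color_regular dP card_index2 tH yH).
- by rewrite /root_side tH groupM // (negPf t1) (negPf tz) (negPf zt1) (negPf ztz).
- rewrite /root_side (negPf yH) eqxx groupMl // (negPf yH) zC mulKg (td_zP dP) andbT.
  by rewrite -zC zyy.
- by rewrite c_t /y -zbh split_color_out ?groupM // mulgA -zC.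
move=> w w1; rewrite c_t; case: (sideP w) => [wH|[h hH w_bh]].
  rewrite (split_color_in _ wH) // mul1g.
  (* The colours in H come from the completing edge, from {1, p}, from {y, yp} = {b t, b (t p)}, and
     from {t, y} = {t, b t}, a forest edge when t^-1 is in P. *)
  case: (hitH w wH w1) => [->|wP|[p pP ->]|[tVP ->]]; [by left | right..].
  - by exists w; rewrite w1 ny // /tree_nbr wH wP split_color_in ?mulg1.
  - have pH := PH p pP; exists (y * p); rewrite -mulgA bh1 ?groupM // mulgA.
    rewrite nyw; last by apply: contraTneq pP => ->; rewrite (td_1P dP).
    by rewrite nbrH // pP -mulgA split_color_out ?groupM.
  have tP : t \notin P by rewrite -(td_inv dP).
  by exists t; rewrite t1 ny // /tree_nbr tH (negPf tP) (negPf tz) /y split_color_cross // eqxx.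
have c1h : split_color 1 (b * h) = if h == 1 then h else b * h.
  by rewrite split_color_cross // invg1 mulg1 mul1g.
have [h1|h1] := eqVneq h 1.
  (* Colour 1 at the vertex 1 is that of {1, b} = {1, y t^-1}, a forest edge when t is in P. *)
  rewrite w_bh c1h h1 eqxx; case: hit1 => [<-|tP]; [by left | right].
  have bE : b = y * t^-1 by rewrite mulgK.
  have tVP : t^-1 \notin P by rewrite (td_inv dP) // tP.
  have nb1 : b != 1 by apply: contraNneq bH => ->; rewrite group1.
  have nby : b != y by rewrite bE nyw ?invg_eq1.
  have nbr_b : tree_nbr <[a]> z y P b = 1 by rewrite bE nbrH ?groupV // (negPf tVP).
  exists b; rewrite nb1 nby nbr_b split_color_sym -[b]mulg1 split_color_cross //.
  by rewrite eqxx mulg1.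
right; rewrite w_bh c1h (negPf h1).
have [v vH hE] : exists2 v, v \in H & h = t * v.
  by exists (t^-1 * h); rewrite ?mulKVg // groupM ?groupV.
have [v1|v1] := eqVneq v 1.
  exists z; rewrite involution_neq1 ny // /tree_nbr zH (negPf (td_zP dP)) eqxx.
  rewrite hE v1 mulg1 /y -zbh split_color_cross ?groupM // (negPf ztz).
  by rewrite zC -!mulgA mulgV mulg1.
have bhE : b * h = y * v by rewrite hE mulgA.
case: (boolP (v \in P)) => vP; last first.
  have nbh : b * h != y by rewrite bhE nyw.
  have nbr_bh : tree_nbr <[a]> z y P (b * h) = 1 by rewrite bhE nbrH // (negPf vP).
  by exists (b * h); rewrite bh1 // nbh nbr_bh split_color_sym c1h (negPf h1).
have vz : v != z by apply: contraTneq vP => ->; rewrite (td_zP dP).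
exists v^-1; rewrite invg_eq1 v1 ny ?groupV // /tree_nbr groupV vH (td_inv dP) // vP.
have zV : z^-1 = z by apply: (mulgI z); rewrite mulgV zz.
have vVz : v^-1 != z by rewrite -zV (inj_eq invg_inj).
rewrite (negPf vVz) split_color_cross ?groupV // invgK.
have -> : (t == v^-1) = (h == 1) by rewrite hE eq_mulgV1 invgK.
by rewrite (negPf h1) hE mulgA.
Qed.

(** The colours t p t must fill the half of H that P leaves free, so t^2 has to be close to [z]. For
    N odd, t = a^((N-1)/2) shifts the exponents 1, ..., N - 1 of P to N, ..., 2N - 2, and the
    completing edge has colour a^(2N-1). For N even, t = a^(3N/2) satisfies t^2 = z; the completing
    edge then has colour 1 and {t, y} has colour [z]. *)
Lemma split_rainbow : rainbow_decomposable gT.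
Proof.
have powP k : k \in H -> k != 1 -> exists2 i, (0 < i < N.*2)%N & k = a ^+ i.
  move=> /mem_cycleE[i i_lt ->]; rewrite -(expg0 a) expa_eq ?i_lt; try lia.
  by move=> i0; exists i; rewrite // i_lt andbT; lia.
have zt i : z * a ^+ i = a ^+ (N + i) by rewrite expgD.
have [oddN|evenN] := boolP (odd N).
  pose e := N./2; have NE : N = e.*2.+1 by rewrite -[LHS]odd_double_half oddN.
  apply: (@split_rainbow_twist (a ^+ e)).
  - exact: mem_cycle.
  - by rewrite -(expg0 a) expa_eq; lia.
  - by rewrite expa_eq; lia.
  - by rewrite zt !mem_half_powers; lia.
  - by right; rewrite mem_half_powers; lia.
  move=> k kH k1; have [i i_lt ->] := powP k kH k1.
  have [iN|iN] := ltnP i N.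
    by constructor 2; rewrite mem_half_powers; lia.
  have [i_top|i_ntop] := eqVneq i (N + e + e).
    by constructor 1; rewrite zt -expgD i_top.
  constructor 3; exists (a ^+ (i - e - e)); first by rewrite mem_half_powers; lia.
  by rewrite -!expgD; congr (_ ^+ _); lia.
pose e := N./2; have NE : N = e.*2 by rewrite -[LHS]odd_double_half (negPf evenN).
have tt : a ^+ (N + e) * a ^+ (N + e) = z.
  rewrite -expgD; have -> : (N + e + (N + e) = N.*2 + N)%N by lia.
  by rewrite expgD expa_mod mul1g.
apply: (@split_rainbow_twist (a ^+ (N + e))).
- exact: mem_cycle.
- by rewrite -(expg0 a) expa_eq; lia.
- by rewrite expa_eq; lia.
- rewrite zt; have -> : (N + (N + e) = N.*2 + e)%N by lia.
  by rewrite (expgD a N.*2) expa_mod mul1g !mem_half_powers; lia.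
- by left; rewrite -mulgA tt zz.
move=> k kH k1; have [i i_lt ->] := powP k kH k1.
have [iN|iN] := ltnP i N.
  by constructor 2; rewrite mem_half_powers; lia.
have [->|i_nN] := eqVneq i N.
  constructor 4; rewrite tt; split=> //.
  have -> : (a ^+ (N + e))^-1 = a ^+ e.
    apply/eqP; rewrite eq_invg_mul -expgD; have -> : (N + e + e = N.*2)%N by lia.
    by rewrite expa_mod.
  by rewrite mem_half_powers; lia.
constructor 3; exists (a ^+ (i - N)); first by rewrite mem_half_powers; lia.
rewrite -!expgD; have -> : (N + e + (i - N) + (N + e) = N.*2 + i)%N by lia.
by rewrite (expgD a N.*2) expa_mod mul1g.
Qed.

End Split.

End CyclicIndex2.

(** * Cyclic groups of order 8q *)

Section CyclicExponents.
Variables (q m : nat).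
Hypotheses (m_odd : odd m) (m3 : (2 < m)%N) (dvd_mq : (m %| q)%N) (q0 : (0 < q)%N).
Local Open Scope nat_scope.

(* For a generator g of a cyclic group of order 2n = 8q, the colour of an edge {x, w} depends on
   the class of the exponent d of w x^-1.  Class 0 (even d) carries the patterned starter {i, -i},
   whose translates have colour x w.  By a parity obstruction the starter cannot cover the vertices
   0, n/2, n, 3n/2 by even differences: the pair {1, -1} is broken up, and classes 1 and 2 (two odd
   differences) cover the eight vertices left over.  The difference 2 freed in this way, the
   involution n, and one odd difference [cyc_E] for each further residue +-r mod m make up a
   starter modulo m, class 3, in which the colour is the exponent of x w mod m. *)
Definition cyc_E d := (d %% 4 == 1) && ((m + 4 <= d < 2 * m) || (3 * m + 4 <= d < 4 * m)).
Definition cyc_F0 d := [|| d == 2, d == 8 * q - 2, d == 4 * q, cyc_E d | cyc_E (8 * q - d)].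
(* The choice between the two lifts of +-(n/2 + 1) modulo n makes the tree rainbow. *)
Definition cyc_d2 := if odd q then 2 * q + 1 else 6 * q + 1.
(** Edges {1, g^p} and {g, g^(1+p)} of class 0 have colours p and p + 2, so P and P + 2 must cover
    the even exponents other than 0, 2, 4q and -2, whose colours are left to classes 1 and 2. The
    difference 2 is of class 3; its edges {1, g^2} and {g, g^3} carry the colours 2 and 4 modulo
    m. *)
Definition cyc_P i :=
  [|| i == 2, (i %% 4 == 0) && (0 < i < 4 * q) | (i %% 4 == 2) && (4 * q < i < 8 * q - 2)].
Definition cyc_class d :=
  if cyc_F0 d then 3 else if (d == 1) || (d == 8 * q - 1) then 1
  else if (d == cyc_d2) || (d == 8 * q - cyc_d2) then 2
  else if odd d then 4 else 0.

Lemma cyc_mq : m <= q. Proof. exact: dvdn_leq. Qed.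

Lemma cyc_class_sym d : 0 < d < 8 * q -> cyc_class (8 * q - d) = cyc_class d.
Proof.
move=> d_lt; have := cyc_mq.
rewrite /cyc_class /cyc_F0 /cyc_d2 (_ : 8 * q - (8 * q - d) = d); last by lia.
move=> mq.
have -> : (8 * q - d == 2) = (d == 8 * q - 2) by lia.
have -> : (8 * q - d == 8 * q - 2) = (d == 2) by lia.
have -> : (8 * q - d == 4 * q) = (d == 4 * q) by lia.
have -> : (8 * q - d == 1) = (d == 8 * q - 1) by lia.
have -> : (8 * q - d == 8 * q - 1) = (d == 1) by lia.
have -> : odd (8 * q - d) = odd d by lia.
have d2E : (8 * q - d == cyc_d2) || (8 * q - d == 8 * q - cyc_d2) = (d == cyc_d2) || (d == 8 * q - cyc_d2).
  by rewrite /cyc_d2; case: ifP => _; lia.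
rewrite -/cyc_d2 d2E [cyc_E d || _]orbC.
by rewrite [(d == 8 * q - 2) || _]orbCA [(d == 8 * q - 1) || _]orbC.
Qed.

Lemma cyc_res_E d : cyc_E d -> exists2 l, d %% m = l & [&& 4 <= l, l < m, ~~ odd l & (d == m + l) || (d == 3 * m + l)].
Proof.
move=> Ed; have [l [l_lt [dE|dE]]] : exists l, l < m /\ (d = l + m \/ d = l + 3 * m).
- case/andP: Ed => _ /orP[] d_in; [exists (d - m) | exists (d - 3 * m)]; lia.
- exists l; first by rewrite dE modnDr modn_small.
  by move: Ed; rewrite /cyc_E; lia.
exists l; first by rewrite dE addnC modnMDl modn_small.
by move: Ed; rewrite /cyc_E; lia.
Qed.

Lemma cyc_dvdL : m %| 8 * q. Proof. exact: dvdn_mull. Qed.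

Lemma cyc_res_opp d : d <= 8 * q -> 0 < (8 * q - d) %% m -> d %% m = m - (8 * q - d) %% m.
Proof.
move=> d_le; set e := 8 * q - d => e0.
have m0 : 0 < m by lia.
have dvd_de : m %| d %% m + e %% m.
  by rewrite /dvdn modnDm subnKC // -/(dvdn _ _) cyc_dvdL.
have := ltn_pmod d m0; have := ltn_pmod e m0.
move=> e_lt d_lt; have /dvdnP[[|[|k]] kE] := dvd_de; rewrite ?mulSn in kE; lia.
Qed.

Lemma cyc_F0_res d : d < 8 * q -> cyc_F0 d -> let r := d %% m in
  [\/ r = 0 /\ d = 4 * q, r = 2 /\ d = 2, r = m - 2 /\ d = 8 * q - 2
    | (2 < r < m /\ ~~ odd r) /\ ((d = m + r \/ d = 3 * m + r) /\ d %% 4 = 1)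
      \/ (0 < r < m - 2 /\ odd r) /\
        ((8 * q - d = 2 * m - r \/ 8 * q - d = 4 * m - r) /\ (8 * q - d) %% 4 = 1)].
Proof.
have mq := cyc_mq; have m0 : 0 < m by lia.
move=> d_lt /or4P[/eqP->|/eqP->|/eqP->|/orP[Ed|Ed]] r.
- by constructor 2; rewrite /r modn_small.
- have opp2 : 8 * q - (8 * q - 2) = 2 by lia.
  by constructor 3; split=> //; rewrite /r cyc_res_opp ?opp2 ?modn_small //; lia.
- by constructor 1; split=> //; apply/eqP; apply: dvdn_mull.
- case: (cyc_res_E Ed) => l lE l_in; constructor 4; left; rewrite /r lE.
  have /andP[/eqP d4 _] := Ed; clear -l_in d4; lia.
case: (cyc_res_E Ed) => l lE l_in; have /andP[/eqP d4 _] := Ed.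
have rE : r = m - l by rewrite /r cyc_res_opp ?lE // ?(ltnW d_lt); clear -l_in; lia.
constructor 4; right; rewrite rE; clear -l_in d4 m_odd; lia.
Qed.

Lemma cyc_F0_inj d d' : d < 8 * q -> d' < 8 * q -> cyc_F0 d -> cyc_F0 d' -> d = d' %[mod m] -> d = d'.
Proof.
move=> d_lt d'_lt /(cyc_F0_res d_lt) + /(cyc_F0_res d'_lt) + eq_r; rewrite -eq_r /=.
have mq := cyc_mq; move: (d %% m) => r; clear -d_lt d'_lt mq m3 m_odd.
by case=> [[? ?]|[? ?]|[? ?]|[[? ?]|[? ?]]] [[? ?]|[? ?]|[? ?]|[[? ?]|[? ?]]]; lia.
Qed.

Lemma cyc_E_even l : 3 < l < m -> ~~ odd l -> exists2 d, cyc_E d & d = l %[mod m].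
Proof.
move=> l_in l_even; have [l1|l1] := boolP ((m + l) %% 4 == 1).
  by exists (m + l); rewrite ?modnDl // /cyc_E l1; clear -l_in; lia.
by exists (3 * m + l); rewrite ?modnMDl // /cyc_E; clear -l_in l_even l1 m_odd; lia.
Qed.

Lemma cyc_E_lt d : cyc_E d -> 0 < d < 8 * q.
Proof. by have := cyc_mq; rewrite /cyc_E; clear -m3; lia. Qed.

Lemma cyc_F0_opp d : 0 < d < 8 * q -> cyc_F0 d -> cyc_F0 (8 * q - d).
Proof.
move=> d_lt; rewrite /cyc_F0 (_ : 8 * q - (8 * q - d) = d); last by clear -d_lt; lia.
by case/or4P=> [/eqP->|/eqP->|/eqP->|/orP[]->]; rewrite ?orbT //; clear -q0; lia.
Qed.

Lemma cyc_F0_surj s : exists d, [/\ 0 < d < 8 * q, cyc_F0 d & d = s %[mod m]].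
Proof.
have m0 : 0 < m by apply: ltn_trans m3.
have r_lt := ltn_pmod s m0; move: (s %% m) r_lt => r r_lt.
have even_case l : l < m -> ~~ odd l -> exists d, [/\ 0 < d < 8 * q, cyc_F0 d & d %% m = l].
  move=> l_lt l_even; have [l3|l3] := ltnP 3 l.
    have [|//|d Ed dE] := @cyc_E_even l; first by rewrite l3.
    exists d; rewrite /cyc_F0 Ed !orbT cyc_E_lt // dE modn_small //.
  have [->|->] : l = 0 \/ l = 2 by clear -l3 l_even; lia.
    exists (4 * q); rewrite /cyc_F0 eqxx !orbT; split=> //; first by clear -q0; lia.
    by apply/eqP/dvdn_mull.
  exists 2; rewrite modn_small //; split=> //; clear -q0; lia.
have [r_odd|r_even] := boolP (odd r); last exact: even_case.
(* As m is odd, odd residues are the opposites of even ones. *)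
have [||d [d_in Fd dE]] := even_case (m - r).
- by clear -r_odd r_lt; lia.
- by clear -m_odd r_odd r_lt; lia.
exists (8 * q - d); split; [by clear -d_in; lia | exact: cyc_F0_opp |].
have dvd_d : m %| d + r by rewrite /dvdn -modnDml dE subnK ?modnn // ltnW.
have d_le : d <= 8 * q by case/andP: d_in => _ /ltnW.
rewrite -[RHS](modn_small r_lt); apply/eqP; rewrite -(eqn_modDl d) subnKC //.
by rewrite (eqP cyc_dvdL) (eqP dvd_d).
Qed.

Lemma cyc_P_opp i : 0 < i < 8 * q -> ~~ odd i -> i != 4 * q -> cyc_P (8 * q - i) = ~~ cyc_P i.
Proof. by rewrite /cyc_P; clear -q0; lia. Qed.

End CyclicExponents.

(** * Colouring and rainbow tree of the cyclic group *)

Section CyclicGroup.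
Variables (gT : finGroupType) (g : gT) (q m : nat).
Hypotheses (m_odd : odd m) (m3 : (2 < m)%N) (dvd_mq : (m %| q)%N) (q0 : (0 < q)%N).
Hypotheses (og : #[g] = (8 * q)%N) (card_gT : #|gT| = (8 * q)%N).
Local Notation L := (8 * q)%N.
Local Notation d2 := (cyc_d2 q).

Lemma g_powers x : exists2 i, (i < L)%N & x = g ^+ i.
Proof.
have xG : x \in <[g]>.
  have -> : <[g]> = [set: gT] by apply/eqP; rewrite eqEcard subsetT cardsT card_gT -orderE og /=.
  by rewrite inE.
by have [i i_lt ->] := cyclePmin xG; exists i; rewrite // -og.
Qed.

Lemma expg_modL i : g ^+ (i %% L) = g ^+ i.
Proof. by rewrite -og expg_mod_order. Qed.

Lemma expg_eqL i j : (g ^+ i == g ^+ j) = (i == j %[mod L]).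
Proof. by rewrite eq_expg_mod_order og. Qed.

Lemma expgL : g ^+ L = 1. Proof. by rewrite -og expg_order. Qed.

Definition lg (x : gT) : nat := index x [seq g ^+ i | i <- iota 0 L].

Lemma lgX i : lg (g ^+ i) = (i %% L)%N.
Proof.
have L0 : (0 < L)%N by rewrite muln_gt0.
rewrite -expg_modL; have := ltn_pmod i L0; move: (i %% L)%N => j j_lt.
have -> : g ^+ j = nth 1 [seq g ^+ i | i <- iota 0 L] j.
  by rewrite (nth_map 0) ?size_iota // nth_iota.
rewrite /lg index_uniq ?size_map ?size_iota // map_inj_in_uniq ?iota_uniq // => k l.
by rewrite !mem_iota => /= k_lt l_lt /eqP; rewrite expg_eqL !modn_small // => /eqP.
Qed.

Lemma oddmodL i : odd (i %% L) = odd i.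
Proof. by rewrite [in RHS](divn_eq i L) oddD !oddM andbF. Qed.

Lemma modL_m i : (i %% L %% m = i %% m)%N.
Proof. by rewrite modn_dvdm ?(cyc_dvdL dvd_mq). Qed.

(** Natural number subtraction turns the shifts -1 and 2 - d2 into L - 1 and L + 2 - d2. They give
    the edges from 1 to g, g^-1, g^d2 and g^-d2 the colours 0, -2, 2 and 4q, exactly the even
    colours that class 0 lacks at 1. In class 4 the colour is the difference from the end with even
    exponent to the other. *)
Definition cyc_color (x w : gT) : nat * nat :=
  let d := lg (w * x^-1) in let s := lg (x * w) in
  match cyc_class q m d with
  | 0 => (0, s)
  | 1 => (0, (s + (L - 1)) %% L)
  | 2 => (0, (s + (L + 2 - d2)) %% L)
  | 3 => (1, s %% m)
  | _ => (2, if odd (lg x) then L - d else d)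
  end%N.

Definition cyc_col (i d : nat) : nat * nat :=
  match cyc_class q m d with
  | 0 => (0, (2 * i + d) %% L)
  | 1 => (0, (2 * i + d + (L - 1)) %% L)
  | 2 => (0, (2 * i + d + (L + 2 - d2)) %% L)
  | 3 => (1, (2 * i + d) %% m)
  | _ => (2, if odd i then L - d else d)
  end%N.

Lemma cyc_colorE i d : (d < L)%N -> cyc_color (g ^+ i) (g ^+ (i + d)) = cyc_col i d.
Proof.
move=> d_lt; rewrite /cyc_color /cyc_col addnC expgD mulgK (lgX d) (modn_small d_lt).
have -> : g ^+ i * (g ^+ d * g ^+ i) = g ^+ (2 * i + d).
  by rewrite -!expgD; congr (_ ^+ _); lia.
by rewrite !lgX oddmodL modL_m !modnDml.
Qed.

Lemma cyc_colorP x w : x != w -> exists i d, [/\ (0 < d < L)%N, x = g ^+ i & w = g ^+ (i + d)].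
Proof.
move=> xw; have [i i_lt xE] := g_powers x; have [d d_lt dE] := g_powers (w * x^-1).
exists i, d; rewrite d_lt andbT xE addnC expgD -dE -xE mulgKV; split=> //.
by case: d dE {d_lt} => // /eqP; rewrite expg0 -eq_mulgV1 eq_sym (negPf xw).
Qed.

Lemma cyc_class_odd d : cyc_class q m d = 4 -> odd d.
Proof. by rewrite /cyc_class; do 3 case: ifP => // _; case: ifP. Qed.

Lemma cyc_d2_lt : (0 < d2 < L)%N.
Proof. by rewrite /cyc_d2; case: ifP => _; clear -q0; lia. Qed.

Lemma cyc_color_sym x w : cyc_color x w = cyc_color w x.
Proof.
have [-> //|/cyc_colorP[i [d [d_in -> ->]]]] := eqVneq x w.
have d_lt : (d < L)%N by case/andP: d_in.
rewrite cyc_colorE //.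
have -> : g ^+ i = g ^+ (i + d + (L - d)) by rewrite -addnA subnKC ?(ltnW d_lt) // expgD expgL mulg1.
rewrite cyc_colorE; last by clear -d_in; lia.
rewrite /cyc_col cyc_class_sym //.
have -> : (2 * (i + d) + (L - d) = 2 * i + d + L)%N by clear -d_lt; lia.
case cl: (cyc_class q m d) => [|[|[|[|k]]]] /=.
- by rewrite modnDr.
- by rewrite [in RHS]addnAC modnDr.
- by rewrite [in RHS]addnAC modnDr.
- by rewrite -[in RHS]modnDmr (eqP (cyc_dvdL dvd_mq)) addn0.
have d_odd : odd d.
  by move: cl; rewrite /cyc_class; do 3 case: ifP => // _; case: ifP.
by rewrite oddD d_odd; case: (odd i) => //=; rewrite subKn // ltnW.
Qed.

Lemma cyc_color_shift h : color_shift cyc_color h.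
Proof.
have shift_g : color_shift cyc_color g.
  (* Translation by [g] adds 2 to a sum of exponents; in class 4 it exchanges the parities of the
     ends and so reverses the difference. *)
  pose f (k : nat * nat) : nat * nat := match k with
    | (0, e) => (0, (e + 2) %% L) | (1, e) => (1, (e + 2) %% m) | (j, e) => (j, L - e) end%N.
  apply: (color_shift_map (f := f)).
  move=> x w /cyc_colorP[i [d [/andP[_ d_lt] -> ->]]].
  rewrite -!expgSr -addSn !cyc_colorE // /cyc_col.
  have -> : (2 * i.+1 + d = 2 * i + d + 2)%N by lia.
  case: (cyc_class q m d) => [|[|[|[|k]]]] /=.
  - by rewrite modnDml.
  - by rewrite modnDml addnAC.
  - by rewrite modnDml addnAC.
  - by rewrite modnDml.
  by case: (odd i) => //=; rewrite subKn // ltnW.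
have [i _ ->] := g_powers h; elim: i => [|i IHi].
  by move=> x y x' y' _ _; rewrite expg0 !mulg1.
by rewrite expgSr; apply: color_shiftM.
Qed.

Lemma cyc_col0 d : (0 < d < L)%N ->
  [\/ cyc_class q m d = 0 /\ ([/\ ~~ odd d, d != 2, d != 4 * q & d != L - 2] /\ cyc_col 0 d = (0, d)),
      cyc_class q m d = 1 /\ (d = 1 /\ cyc_col 0 d = (0, 0) \/ d = L - 1 /\ cyc_col 0 d = (0, L - 2)),
      cyc_class q m d = 2 /\ (d = d2 /\ cyc_col 0 d = (0, 2) \/ d = L - d2 /\ cyc_col 0 d = (0, 4 * q))
    | cyc_class q m d = 3 /\ (cyc_F0 q m d /\ cyc_col 0 d = (1, d %% m))
      \/ cyc_class q m d = 4 /\ cyc_col 0 d = (2, d)]%N.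
Proof.
move=> d_in; have d_lt : (d < L)%N by case/andP: d_in.
rewrite /cyc_col muln0 add0n; case cl: (cyc_class q m d) => [|[|[|[|k]]]] /=.
- constructor 1; rewrite modn_small //; split=> //; split=> //.
  move: cl; rewrite /cyc_class; case: ifP => // /negbT F0d; do 2 case: ifP => // _; case: ifP => // d_odd _.
  by move: F0d; rewrite /cyc_F0 !negb_or => /and5P[-> -> -> _ _].
- constructor 2; split=> //; move: cl; rewrite /cyc_class; case: ifP => // _; case: ifP => [|_]; last by do 2 case: ifP => // _.
  case/orP=> /eqP-> _; [left | right]; split=> //; congr (_, _).
    by rewrite subnKC ?modnn //; clear -q0; lia.
  have -> : (L - 1 + (L - 1) = L - 2 + L)%N by clear -q0; lia.
  by rewrite modnDr modn_small //; clear -q0; lia.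
- constructor 3; split=> //; move: cl; rewrite /cyc_class; do 2 case: ifP => // _; case: ifP => [|_]; last by case: ifP.
  have := cyc_d2_lt => d2_in.
  case/orP=> /eqP-> _; [left | right]; split=> //; congr (_, _).
    have -> : (d2 + (L + 2 - d2) = 2 + L)%N by clear -d2_in; lia.
    by rewrite modnDr modn_small //; clear -q0; lia.
  rewrite /cyc_d2; case: ifP => _.
    have -> : (L - (2 * q + 1) + (L + 2 - (2 * q + 1)) = 4 * q + L)%N by clear -q0; lia.
    by rewrite modnDr modn_small //; clear -q0; lia.
  have -> : (L - (6 * q + 1) + (L + 2 - (6 * q + 1)) = 4 * q)%N by clear -q0; lia.
  by rewrite modn_small //; clear -q0; lia.
- constructor 4; left; split=> //; split=> //.
  by move: cl; rewrite /cyc_class; case: ifP => // _; do 2 case: ifP => // _; case: ifP.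
have k0 : k = 0%N.
  by move: cl; rewrite /cyc_class; do 3 case: ifP => // _; case: ifP => // _ [].
by constructor 4; right; rewrite k0.
Qed.

Lemma cyc_col0_inj d d' : (0 < d < L)%N -> (0 < d' < L)%N -> cyc_col 0 d = cyc_col 0 d' -> d = d'.
Proof.
move=> d_in d'_in; have d2_in := cyc_d2_lt.
case: (cyc_col0 d_in) => [[_ [[? ? ? ?] ->]]|[_ [[? ->]|[? ->]]]|[_ [[? ->]|[? ->]]]|[[_ [Fd ->]]|[_ ->]]];
case: (cyc_col0 d'_in) => [[_ [[? ? ? ?] ->]]|[_ [[? ->]|[? ->]]]|[_ [[? ->]|[? ->]]]|[[_ [Fd' ->]]|[_ ->]]] //;
  move=> e; have := congr1 snd e => /= {}e; try by [].
all: try lia.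
by apply: (cyc_F0_inj m_odd m3 dvd_mq q0 _ _ Fd Fd' e); [case/andP: d_in | case/andP: d'_in].
Qed.

Lemma cyc_class_F0 d : cyc_F0 q m d -> cyc_class q m d = 3%N.
Proof. by rewrite /cyc_class => ->. Qed.

Lemma cyc_class_even d : ~~ odd d -> (0 < d < L)%N -> d != 2%N -> d != (4 * q)%N -> d != (L - 2)%N ->
  cyc_class q m d = 0%N.
Proof.
move=> d_even d_in d_2 d_4q d_L2; rewrite /cyc_class /cyc_F0 /cyc_E /cyc_d2 (negPf d_even).
have L4 : ((L - d) %% 4 != 1)%N by clear -d_even d_in; lia.
have d4 : (d %% 4 != 1)%N by clear -d_even; lia.
rewrite (negPf d_2) (negPf d_4q) (negPf d_L2) (negPf d4) (negPf L4) /=.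
by case: (odd q); do 2 (rewrite ifF; last by clear -d_even d_in; lia).
Qed.

Lemma cyc_class_1 : cyc_class q m 1%N = 1%N.
Proof. by rewrite /cyc_class /cyc_F0 /cyc_E ifF //; clear -q0 m3; lia. Qed.

Lemma cyc_class_d2 : cyc_class q m d2 = 2%N.
Proof.
have mq := cyc_mq dvd_mq q0; rewrite /cyc_class eqxx /cyc_F0 /cyc_E /cyc_d2.
by case: (boolP (odd q)) => q_odd; do 2 (rewrite ifF; last by clear -q_odd q0 mq m3; lia).
Qed.

Lemma cyc_even_hit e : ~~ odd e -> (e < L)%N -> exists2 d, (0 < d < L)%N & cyc_col 0 d = (0, e)%N.
Proof.
move=> e_even e_lt; have d2_in := cyc_d2_lt.
have col1 := cyc_class_1; have cold2 := cyc_class_d2.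
have [->|e0] := eqVneq e 0%N.
  exists 1%N; rewrite /cyc_col ?col1 ?muln0 ?add0n; first by clear -q0; lia.
  by rewrite subnKC ?modnn //; clear -q0; lia.
have [->|e2] := eqVneq e 2.
  exists d2; rewrite // /cyc_col cold2 muln0 add0n.
  have -> : (d2 + (L + 2 - d2) = 2 + L)%N by clear -d2_in; lia.
  by rewrite modnDr modn_small //; clear -q0; lia.
have [->|e4] := eqVneq e (4 * q)%N.
  exists (L - d2)%N; first by clear -d2_in; lia.
  rewrite /cyc_col cyc_class_sym // cold2 muln0 add0n /cyc_d2; case: ifP => _.
    have -> : (L - (2 * q + 1) + (L + 2 - (2 * q + 1)) = 4 * q + L)%N by clear -q0; lia.
    by rewrite modnDr modn_small //; clear -q0; lia.
  have -> : (L - (6 * q + 1) + (L + 2 - (6 * q + 1)) = 4 * q)%N by clear -q0; lia.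
  by rewrite modn_small //; clear -q0; lia.
have [->|eL] := eqVneq e (L - 2)%N.
  exists (L - 1)%N; first by clear -q0; lia.
  rewrite /cyc_col cyc_class_sym //; last by clear -q0; lia.
  have -> : (2 * 0 + (L - 1) + (L - 1) = L - 2 + L)%N by clear -q0; lia.
  by rewrite col1 modnDr modn_small //; clear -q0; lia.
have e_in : (0 < e < L)%N by rewrite e_lt lt0n e0.
exists e; rewrite // /cyc_col cyc_class_even //.
by rewrite muln0 add0n modn_small.
Qed.

Lemma cyc_color1 d : (d < L)%N -> cyc_color 1 (g ^+ d) = cyc_col 0 d.
Proof. by move=> d_lt; rewrite -cyc_colorE. Qed.

Lemma expg_neq1 d : (0 < d < L)%N -> g ^+ d != 1.
Proof.
case/andP=> d0 d_lt; rewrite -(expg0 g) expg_eqL modn_small // mod0n.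
by rewrite -lt0n.
Qed.

Lemma cyc_color_regular : regular_coloring cyc_color.
Proof.
apply: regular_coloring_from1.
- exact: cyc_color_sym.
- exact: cyc_color_shift.
- have pw w : w \in predC1 1 -> exists2 d, (0 < d < L)%N & w = g ^+ d.
    rewrite inE eq_sym => /cyc_colorP[i [d [d_in i1 ->]]].
    by exists d; rewrite // expgD -i1 mul1g.
  move=> w w' /pw[d d_in ->] /pw[d' d'_in ->].
  rewrite !cyc_color1; try by [case/andP: d_in | case/andP: d'_in].
  by move/cyc_col0_inj=> ->.
move=> x w /cyc_colorP[i [d [d_in -> ->]]]; rewrite cyc_colorE; last by case/andP: d_in.
suff [d' d'_in <-] : exists2 d', (0 < d' < L)%N & cyc_col 0 d' = cyc_col i d.
  by exists (g ^+ d'); rewrite ?expg_neq1 // cyc_color1 //; case/andP: d'_in.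
have L0 : (0 < L)%N by rewrite muln_gt0.
have even_L e : ~~ odd e -> exists2 d', (0 < d' < L)%N & cyc_col 0 d' = (0, e %% L)%N.
  by move=> e_even; apply: cyc_even_hit; rewrite ?oddmodL ?ltn_pmod.
rewrite [cyc_col i d]/cyc_col; case cl: (cyc_class q m d) => [|[|[|[|k]]]].
- apply: even_L; rewrite oddD oddM /=.
  by move: cl; rewrite /cyc_class; do 3 case: ifP => // _; case: ifP => // /negbT.
- apply: even_L; move: cl; rewrite /cyc_class; case: ifP => // _; case: ifP => [|_]; last by do 2 case: ifP => // _.
  by case/orP=> /eqP-> _; clear -q0; lia.
- apply: even_L; move: cl; rewrite /cyc_class; do 2 case: ifP => // _; case: ifP => [|_]; last by case: ifP.
  by case/orP=> /eqP-> _; rewrite /cyc_d2; case: ifP => _; clear -q0; lia.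
- have [d' [d'_in Fd' dE]] := cyc_F0_surj m_odd m3 dvd_mq q0 (2 * i + d).
  by exists d'; rewrite // /cyc_col cyc_class_F0 // muln0 add0n dE.
have k0 : k = 0%N.
  by move: cl; rewrite /cyc_class; do 3 case: ifP => // _; case: ifP => // _ [].
case: (odd i); last by exists d; rewrite // /cyc_col cl.
exists (L - d)%N; first by clear -d_in; lia.
by rewrite /cyc_col cyc_class_sym // cl.
Qed.

Definition cyc_half : {set gT} := [set x | cyc_P q (lg x)].

Lemma mem_cyc_half i : (i < L)%N -> (g ^+ i \in cyc_half) = cyc_P q i.
Proof. by move=> i_lt; rewrite inE lgX modn_small. Qed.

Lemma mem_even_powers i : (g ^+ i \in <[g ^+ 2]>) = ~~ odd i.
Proof.
apply/cycleP/idP => [[k /eqP]|i_even]; last first.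
  by exists i./2; rewrite -expgM mul2n -{1}(odd_double_half i) (negPf i_even).
by rewrite -expgM expg_eqL => /eqP/(congr1 odd); rewrite !oddmodL oddM /= => ->.
Qed.

Lemma cyc_tree_data : tree_data <[g ^+ 2]> (g ^+ (4 * q)) g cyc_half.
Proof.
have L0 : (0 < L)%N by rewrite muln_gt0.
have comm (x w : gT) : x * w = w * x.
  by have [i _ ->] := g_powers x; have [j _ ->] := g_powers w; rewrite -!expgD addnC.
split.
- by rewrite -[g]expg1 mem_even_powers.
- move=> h; have [i _ ->] := g_powers h; rewrite mem_even_powers negbK => i_odd.
  rewrite -{1}(odd_double_half i) i_odd add1n expgS mulKg mem_even_powers.
  by rewrite odd_double.
- by rewrite mem_even_powers oddM.
- by apply: expg_neq1; clear -q0; lia.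
- by rewrite -expgD (_ : 4 * q + 4 * q = L)%N ?expgL //; lia.
- by move=> h; apply: comm.
- apply/subsetP=> x; have [i i_lt ->] := g_powers x; rewrite mem_cyc_half // mem_even_powers /cyc_P.
  by clear -i_lt; lia.
- by rewrite -(expg0 g) mem_cyc_half.
- by rewrite mem_cyc_half /cyc_P; clear -q0 m3 dvd_mq; have := cyc_mq dvd_mq q0; lia.
move=> h; have [i i_lt ->] := g_powers h; rewrite mem_even_powers => i_even i1 iz.
have i0 : (0 < i < L)%N by rewrite i_lt andbT lt0n; apply: contraNneq i1 => ->; rewrite expg0.
have -> : (g ^+ i)^-1 = g ^+ (L - i).
  by apply/eqP; rewrite eq_invg_mul -expgD subnKC ?expgL // ltnW.
rewrite !mem_cyc_half //; last by clear -i0; lia.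
by apply: (cyc_P_opp q0) => //; apply: contraNneq iz => ->.
Qed.

Lemma cyclic_rainbow : rainbow_decomposable gT.
Proof.
have mq := cyc_mq dvd_mq q0; have L0 : (0 < L)%N by rewrite muln_gt0.
have dP := cyc_tree_data.
set z := g ^+ (4 * q); set P := cyc_half.
pose nbr := tree_nbr <[g ^+ 2]> z g P.
have cardH : #|gT| = (2 * #|<[g ^+ 2]>|)%N.
  rewrite -orderE orderXdiv og; first by rewrite mulnC divnK ?card_gT // (dvdn_mulr _ (_ : 2 %| 8)).
  exact: (dvdn_mulr _ (_ : 2 %| 8)).
have subX i j : (j <= i)%N -> (g ^+ j)^-1 * g ^+ i = g ^+ (i - j).
  by move=> ji; apply/eqP; rewrite -(inj_eq (mulgI (g ^+ j))) mulKVg -expgD subnKC.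
have oddP i : (i < L)%N -> odd i -> (g^-1 * g ^+ i \in P) = cyc_P q (i - 1).
  move=> i_lt i_odd; rewrite -{1}[g]expg1 subX ?mem_cyc_half //; last by case: i i_odd {i_lt}.
  by clear -i_lt; lia.
have expg_neqg i : (i < L)%N -> i != 1%N -> g ^+ i != g.
  by move=> i_lt i1; rewrite -[X in _ != X]expg1 expg_eqL !modn_small //; clear -q0; lia.
have nbr_even i : (i < L)%N -> ~~ odd i ->
    nbr (g ^+ i) = if cyc_P q i then 1 else if i == (4 * q)%N then z * g else g.
  move=> i_lt i_even; rewrite /nbr /tree_nbr mem_even_powers i_even mem_cyc_half // expg_eqL.
  by rewrite !modn_small //; clear -q0; lia.
have nbr_odd i : (i < L)%N -> odd i -> nbr (g ^+ i) = if cyc_P q (i - 1) then g else 1.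
  by move=> i_lt i_odd; rewrite /nbr /tree_nbr mem_even_powers i_odd /= oddP.
pose hit k := exists t, [/\ t != 1, t != g & cyc_color t (nbr t) = k].
have hit_one d : (1 < d < L)%N -> nbr (g ^+ d) = 1 -> hit (cyc_col 0 d).
  case/andP=> d1 d_lt nbr1; exists (g ^+ d); rewrite nbr1 cyc_color_sym cyc_color1 //.
  by rewrite expg_neq1 ?expg_neqg ?(ltnW d1) // gtn_eqF.
have hit_y e : (0 < e < L - 1)%N -> nbr (g ^+ (1 + e)) = g -> hit (cyc_col 1 e).
  move=> e_in nbrg; have e_lt : (e < L)%N by clear -e_in; lia.
  have := cyc_colorE 1 e_lt; rewrite expg1 cyc_color_sym => cy.
  exists (g ^+ (1 + e)); rewrite nbrg cy expg_neq1 ?expg_neqg //; clear -e_in; lia.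
have z_edge i : cyc_color (g ^+ i) (z * g ^+ i) = (1, (2 * i) %% m)%N.
  rewrite /z -expgD addnC cyc_colorE; last by clear -q0; lia.
  rewrite /cyc_col cyc_class_F0 ?/cyc_F0 ?eqxx ?orbT //.
  by rewrite -modnDmr (eqP (dvdn_mull 4 dvd_mq)) addn0.
(* The forest misses only the colour 0 of class 3, and {g^i, z g^i} has colour 2i modulo m, so the
   completing edges start at multiples of m. The exponent -2m is 2 modulo 4 and in the upper half,
   so u is in P while zu is not. *)
have um : (2 * (L - 2 * m) %% m = 0)%N.
  by apply/eqP; rewrite -/(dvdn _ _) dvdn_mull // dvdn_sub ?(cyc_dvdL dvd_mq) ?dvdn_mull.
(* One of m and 3m is 1 modulo 4; then g^(vm - 1) lies in P and its product with [z] does not, which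
   separates the sides. *)
pose vm := (if m %% 4 == 1 then m else 3 * m)%N.
have vm_m : (2 * vm %% m = 0)%N.
  by apply/eqP; rewrite -/(dvdn _ _) /vm; case: ifP => _; rewrite !dvdn_mull.
have [vm4 vm_lt] : (vm %% 4 = 1 /\ 3 <= vm < 4 * q)%N.
  by rewrite /vm; case: ifP => m4; clear -m4 mq m3 m_odd; lia.
pose u := g ^+ (L - 2 * m); pose v := g ^+ vm.
have uH : u \in <[g ^+ 2]> by rewrite mem_even_powers; clear -mq; lia.
have vH : v \notin <[g ^+ 2]> by rewrite mem_even_powers; clear -vm4; lia.
have zu : z * u = g ^+ (4 * q - 2 * m).
  rewrite /z /u -expgD -[LHS]expg_modL.
  have -> : (4 * q + (L - 2 * m) = 4 * q - 2 * m + L)%N by clear -mq; lia.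
  by rewrite modnDr expg_modL.
have zv : z * v = g ^+ (4 * q + vm) by rewrite /z /v -expgD.
apply: (coloring_rainbow_decomposition cyc_color_regular dP cardH uH vH).
- rewrite /root_side uH zu mem_even_powers -(expg0 g) /z !expg_eqL /u.
  rewrite !mem_cyc_half ?mod0n ?(@modn_small _ L); try by clear -mq m3; lia.
  have zuH : ~~ odd (4 * q - 2 * m) by clear -mq; lia.
  have Pu : cyc_P q (L - 2 * m) by rewrite /cyc_P; clear -mq m3 m_odd; lia.
  have nPzu : cyc_P q (4 * q - 2 * m) = false by rewrite /cyc_P; clear -mq m3 m_odd; lia.
  by rewrite Pu nPzu zuH !orbT; clear -mq m3; lia.
- have zvH : z * v \notin <[g ^+ 2]> by rewrite zv mem_even_powers; clear -vm4; lia.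
  rewrite /root_side (negPf vH) (negPf zvH) zv /v !oddP ?expg_neqg; try by clear -vm4 vm_lt; lia.
  by rewrite /cyc_P; clear -vm4 vm_lt; lia.
- by rewrite !z_edge um vm_m.
move=> w; rewrite eq_sym => /cyc_colorP[i [d [d_in i1 wE]]].
have {i i1 wE}-> : w = g ^+ d by rewrite wE expgD -i1 mul1g.
have d_lt : (d < L)%N by case/andP: d_in.
rewrite z_edge um cyc_color1 // -/nbr -/(hit (cyc_col 0 d)).
case: (cyc_col0 d_in) => [[_ [[d_even d_2 d_4q d_L2] col_d]]|[cl col_d]|[cl dE]|[[cl [Fd col_d]]|[cl col_d]]].
- right; have [Pd|nPd] := boolP (cyc_P q d).
    by apply: hit_one; [clear -d_in d_even; lia | rewrite nbr_even // Pd].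
  have Pe : cyc_P q (d - 2) by move: nPd; rewrite /cyc_P; clear -d_in d_even d_2 d_4q d_L2; lia.
  have d3 : (2 < d)%N by clear -d_in d_even d_2; lia.
  have -> : cyc_col 0 d = cyc_col 1 (d - 2).
    have cl : cyc_class q m (d - 2) = 0%N.
      by apply: cyc_class_even; move: nPd Pe; rewrite /cyc_P; clear -d3 d_even d_lt d_4q q0; lia.
    by rewrite col_d /cyc_col cl muln1 subnKC ?modn_small // ltnW.
  apply: hit_y; first by clear -d3 d_lt; lia.
  rewrite nbr_odd; try by clear -d3 d_even d_lt; lia.
  by rewrite (_ : 1 + (d - 2) - 1 = d - 2)%N ?Pe //; clear; lia.
(* The colour 0 of {1, g} occurs in the forest on {z, zg}, since twice 4q vanishes modulo 8q. *)
- right; case: col_d => -[dE col_d]; last first.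
    apply: hit_one; rewrite ?nbr_odd dE; try by clear -q0; lia.
    by rewrite ifN // /cyc_P; clear -q0; lia.
  have n_lt : (4 * q < L)%N by clear -q0; lia.
  have n_even : ~~ odd (4 * q)%N by rewrite oddM.
  exists z; split; [exact: (td_z1 dP) | by apply: expg_neqg => //; clear -q0; lia |].
  have nPn : cyc_P q (4 * q)%N = false by rewrite /cyc_P; clear -q0; lia.
  have lt1 : (1 < L)%N by clear -q0; lia.
  rewrite nbr_even // nPn eqxx -/z col_d.
  have := cyc_colorE (4 * q)%N lt1; rewrite (expgD g (4 * q) 1) expg1 -/z => ->.
  rewrite /cyc_col cyc_class_1; congr (_, _).
  have -> : (2 * (4 * q) + 1 + (L - 1) = L + L)%N by clear -q0; lia.
  by rewrite modnDr modnn.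
- right; apply: hit_one; first by case: dE => -[-> _]; rewrite /cyc_d2; case: ifP => _; clear -mq m3; lia.
  rewrite nbr_odd //.
    by case: dE => -[-> _]; rewrite ifN // /cyc_P /cyc_d2; case: (boolP (odd q)) => q_odd; clear -q_odd mq m3; lia.
  by case: dE => -[-> _]; rewrite /cyc_d2; case: ifP => _; clear -mq m3; lia.
(* The colour r is sought on {g, g^(1+e)}, where the class 3 difference e lifts r - 2. This edge is
   not in the forest for e = -2, when r = 0 is the colour of the completing edge, nor for e = 4q,
   when r = 2 is the colour of {1, g^2}. *)
- have [e [e_in Fe eE]] := cyc_F0_surj m_odd m3 dvd_mq q0 (d + (L - 2)).
  have e2 : (2 + e = d %[mod m])%N.
    have -> : (d = 2 + (d + (L - 2)) %[mod m])%N.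
      rewrite addnCA subnKC -1?modnDmr ?(eqP (cyc_dvdL dvd_mq)) ?addn0 //; clear -q0; lia.
    by rewrite -modnDmr eE modnDmr.
  rewrite col_d; case/or4P: (Fe) => [/eqP e_2|/eqP e_L2|/eqP e_n|Ee].
  + right; have -> : (1, d %% m)%N = cyc_col 1 e by rewrite /cyc_col cyc_class_F0 // muln1 e2.
    apply: hit_y; rewrite e_2; first by clear -q0 mq m3; lia.
    by rewrite nbr_odd //; clear -q0 mq m3; lia.
  + left; congr (_, _); rewrite -e2 e_L2 subnKC ?(eqP (cyc_dvdL dvd_mq)) //; clear -q0; lia.
  + right; have -> : (1, d %% m)%N = cyc_col 0 2.
      rewrite /cyc_col cyc_class_F0 // muln0 add0n -e2 e_n -modnDmr.
      by rewrite (eqP (dvdn_mull 4 dvd_mq)) addn0.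
    apply: hit_one; first by clear -q0; lia.
    by rewrite nbr_even //; clear -q0; lia.
  (* Since e or -e is 1 modulo 4 and below 4q, 1 + e falls outside P and g^(1+e) is joined to g; the
     condition modulo 4 in [cyc_E] ensures this. *)
  right; have -> : (1, d %% m)%N = cyc_col 1 e by rewrite /cyc_col cyc_class_F0 // muln1 e2.
  move: Ee; rewrite /cyc_E => Ee; apply: hit_y; first by clear -Ee e_in mq m3; lia.
  rewrite nbr_even; try by clear -Ee e_in mq m3; lia.
  by rewrite !ifN // /cyc_P; clear -Ee e_in mq m3; lia.
right; have d_odd := cyc_class_odd cl.
have d1 : d != 1%N by apply: contra_eq_neq cl => ->; rewrite cyc_class_1.
have [Pd|nPd] := boolP (cyc_P q (d - 1)); last first.
  by apply: hit_one; [clear -d_in d1; lia | rewrite nbr_odd // (negPf nPd)].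
(* If d - 1 is in P, then 1 - d is not, so the even vertex g^(1-d) is joined to g, at difference
   d. *)
have -> : cyc_col 0 d = cyc_col 1 (L - d) by rewrite col_d /cyc_col cyc_class_sym // cl /= subKn // ltnW.
apply: hit_y; first by clear -d_in d_odd d1; lia.
have {Pd}nP : ~~ cyc_P q (1 + (L - d)) /\ (1 + (L - d))%N != (4 * q)%N.
  by move: Pd; rewrite /cyc_P; clear -d_in d_odd d1 q0; lia.
case: nP => nP nn; rewrite nbr_even; try by clear -d_in d_odd d1; lia.
by rewrite (negPf nP) (negPf nn).
Qed.

End CyclicGroup.

(** * The four families *)

Section Families.
Variables (gT : finGroupType) (N : nat).
Hypotheses (N1 : (1 < N)%N) (card_gT : #|gT| = (2 * N.*2)%N).

(** The relations only bound the order of a and, as b^2 lies in both <a> and <b>, the index of the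
    intersection in <b>. The order of the group turns the first bound into an equality and keeps b
    out of <a>. *)
Lemma extension_order (a b : gT) :
    <[a]> <*> <[b]> = [set: gT] -> a ^ b \in <[a]> -> b ^+ 2 \in <[a]> -> a ^+ N.*2 = 1 ->
  #[a] = N.*2 /\ b \notin <[a]>.
Proof.
move=> genG abH bbH aN.
have nHb : <[b]> \subset 'N(<[a]>) by rewrite cycle_subG inE -cycleJ cycle_subG.
have le_a : (#[a] <= N.*2)%N by apply: dvdn_leq; [lia | rewrite order_dvdn aN].
have bb_sub : (#[b ^+ 2] <= #|<[a]> :&: <[b]>|)%N.
  by apply: subset_leq_card; rewrite cycle_subG inE bbH mem_cycle.
have le_b : (#[b] <= 2 * #[b ^+ 2])%N.
  rewrite orderXgcd -{1}(divnK (dvdn_gcdl #[b] 2)) mulnC leq_mul2r.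
  by rewrite dvdn_leq ?orbT // dvdn_gcdr.
have := mul_cardG <[a]> <[b]>; rewrite -norm_joinEr // genG cardsT card_gT -!orderE => cE.
have i0 : (0 < #|<[a]> :&: <[b]>|)%N by apply: cardG_gt0.
have oa : #[a] = N.*2.
  apply/eqP; rewrite eqn_leq le_a -(leq_pmul2r i0) -(leq_pmul2l (isT : (0 < 2)%N)) mulnA -cE.
  by rewrite mulnCA leq_mul2l (leq_trans le_b) ?leq_mul2l ?bb_sub ?orbT.
split=> //; apply/negP=> bH; have : (#|gT| <= #[a])%N.
  rewrite -cardsT -genG orderE subset_leq_card // join_subG subxx cycle_subG.
  exact: bH.
rewrite card_gT oa; lia.
Qed.

Lemma square_in_cycle (a b : gT) : #[a] = N.*2 -> b \notin <[a]> -> b * b \in <[a]>.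
Proof.
move=> oa bH; apply: contraNT (bH) => bbH.
by have := index2_coset N1 oa card_gT bH bbH; rewrite mulKg.
Qed.

(** Dividing b by a power of a makes its square 1 or a. In the second case the quotient d generates
    the group. For N odd, d^N lies outside <a> and its square a^N is the involution; for N even, the
    odd part of N exceeds 1 because cyclic 2-groups are excluded. *)
Lemma abelian_rainbow (a b : gT) : #[a] = N.*2 -> b \notin <[a]> -> abelian [set: gT] ->
  ~ (cyclic [set: gT] /\ 2.-group [set: gT]) -> rainbow_decomposable gT.
Proof.
move=> oa bH abG not_c2.
have comm (x w : gT) : x * w = w * x by apply: (centsP abG); rewrite inE.
have [k _ bbE] := mem_cycleE oa (square_in_cycle oa bH).
pose d := b * (a ^+ k./2)^-1.
have dd : d * d = a ^+ odd k.
  rewrite /d -mulgA (mulgA _ b) (comm _ b) -!mulgA -invMg -expgD addnn mulgA bbE.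
  by rewrite -{1}(odd_double_half k) expgD mulgK.
have dH : d \notin <[a]> by rewrite groupMr // groupV mem_cycle.
have [k_odd|k_even] := boolP (odd k); last first.
  by apply: (split_rainbow N1 oa card_gT dH); rewrite dd (negPf k_even).
move: dd; rewrite k_odd expg1 => dd.
have genG : <[d]> = [set: gT].
  have ad : <[a]> \subset <[d]> by rewrite cycle_subG -dd -[d * d]/(d ^+ 2) mem_cycle.
  apply/eqP; rewrite eqEsubset subsetT /=; apply/subsetP=> x _.
  have [xH|xH] := boolP (x \in <[a]>); first exact: (subsetP ad).
  by rewrite -(mulKVg d x) groupM ?cycle_id // (subsetP ad) // (index2_coset N1 oa card_gT).
have od : #[d] = (4 * N)%N by rewrite orderE genG cardsT card_gT; lia.
have [N_odd|N_even] := boolP (odd N).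
  have dNH : d ^+ N \notin <[a]>.
    apply/negP=> /(mem_cycleE oa)[i _ /eqP]; rewrite -dd -[d * d]/(d ^+ 2) -expgM.
    rewrite eq_expg_mod_order od => /eqP/(congr1 odd).
    have odd_mod j : odd (j %% (4 * N)) = odd j.
      by rewrite [in RHS](divn_eq j (4 * N)) oddD !oddM andbF.
    by rewrite !odd_mod oddM N_odd.
  apply: (quaternion_rainbow N1 oa card_gT dNH).
  by rewrite -dd -[d * d]/(d ^+ 2) -expgM mul2n -addnn expgD.
have N0 : (0 < N)%N by lia.
pose m := (N`_2^')%N; have m_odd : odd m.
  by have := part_pnat 2^' N; rewrite p'natE // dvdn2 negbK.
have m_neq1 : m != 1%N.
  rewrite partn_eq1 // pnatNK; apply: contra_notN not_c2 => pN; split.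
    by apply/cyclicP; exists d; rewrite genG.
  by rewrite /pgroup cardsT card_gT -muln2 !pnatM pN.
have q_dvd : (m %| N./2)%N.
  have <- : (m %| 2 * N./2)%N = (m %| N./2)%N by rewrite Gauss_dvdr // coprimen2.
  by rewrite mul2n even_halfK // dvdn_part.
apply: (@cyclic_rainbow gT d N./2 m) => //; lia.
Qed.

(** With a^b = a^r and b^2 = a^k, the square of b a^i is a^(k + (r+1) i), where r is odd and k even.
    If r is 1 modulo 4, then (r+1)/2 is invertible and some i makes this square 1. If r is 3 modulo
    4, then (r-1)/2 is invertible, and since b commutes with b^2, the congruence (r-1) k = 0 modulo
    2N leaves k = 0 or k = N. *)
Lemma two_group_rainbow (a b : gT) : #[a] = N.*2 -> b \notin <[a]> -> 2.-group [set: gT] ->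
  ~~ cyclic [set: gT] -> rainbow_decomposable gT.
Proof.
move=> oa bH pG ncG.
have [k k_lt bbE] := mem_cycleE oa (square_in_cycle oa bH).
have abH : a ^ b \in <[a]>.
  by rewrite /conjg; apply: (index2_coset N1 oa card_gT bH); rewrite groupMl ?cycle_id.
have [r _ abE] := mem_cycleE oa abH.
have aX i j : (a ^+ i == a ^+ j) = (i == j %[mod N.*2]) by rewrite eq_expg_mod_order oa.
have aN : a ^+ N.*2 = 1 by rewrite -oa expg_order.
have pN : 2.-nat N.*2.
  by move: pG; rewrite /pgroup cardsT card_gT pnatM => /andP[].
have inv s : odd s -> exists u v, (u * s = 1 + v * N.*2)%N.
  move=> s_odd; have s0 : (0 < s)%N by case: s s_odd.
  have [e NE] := p_natP pN.
  have /coprimeP[//|[u v /= uv]] : coprime s N.*2 by rewrite NE coprimeXr // coprimen2.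
  by exists u, v; clear -uv; lia.
(* For odd k, a would be a power of b, and b would generate the group. *)
have k_even : ~~ odd k.
  apply: contra ncG => /inv[u [v uv]]; apply/cyclicP; exists b; apply/eqP.
  rewrite eq_sym eqEsubset subsetT /=.
  have ab : <[a]> \subset <[b]>.
    rewrite cycle_subG; have -> : a = b ^+ (2 * u).
      by rewrite expgM -[b ^+ 2]/(b * b) bbE -expgM mulnC uv expgD mulnC expgM aN expg1n mulg1.
    exact: mem_cycle.
  apply/subsetP=> x _; have [xH|xH] := boolP (x \in <[a]>); first exact: (subsetP ab).
  by rewrite -(mulKVg b x) groupM ?cycle_id // (subsetP ab) // (index2_coset N1 oa card_gT).
have conj_a i : (a ^+ i) ^ b = a ^+ (r * i) by rewrite conjXg abE -expgM.
have r_odd : odd r.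
  apply: contraT => r_even; have : a ^+ N == 1.
    rewrite -(inj_eq (@conjg_inj _ b)) conj1g conj_a -(even_halfK r_even) -muln2.
    by rewrite -mulnA mul2n mulnC expgM aN expg1n.
  by rewrite -(expg0 a) (expa_eq oa) //; clear -N1; lia.
have kr : (r * k == k %[mod N.*2])%N.
  by rewrite -aX -conj_a -bbE conjMg /conjg mulKg.
have sq i : (b * a ^+ i) * (b * a ^+ i) = a ^+ (k + r * i + i).
  rewrite !expgD -bbE -conj_a /conjg !mulgA; congr (_ * _).
  by rewrite mulgK.
have bX i : b * a ^+ i \notin <[a]> by rewrite groupMr // mem_cycle.
have [r1|r3] : r %% 4 = 1%N \/ r %% 4 = 3%N by clear -r_odd; lia.
  have [|u [v uv]] := inv ((r + 1)./2); first by clear -r1; lia.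
  (* This solves (r + 1) i = -k modulo 2N: u is inverse to (r + 1)/2, and 2N - 1 stands for -1. *)
  pose i := (u * (k./2 * (N.*2 - 1)))%N.
  apply: (split_rainbow N1 oa card_gT (bX i)); rewrite sq; apply/eqP.
  rewrite -(expg0 a) aX mod0n.
  have rE : (r + 1 = (r + 1)./2 * 2)%N by clear -r1; lia.
  have kE : (k = k./2 * 2)%N by clear -k_even; lia.
  have nE : (N.*2 = (N.*2 - 1) + 1)%N by clear -N1; lia.
  have riE : (r * i + i = (1 + v * N.*2) * (k * (N.*2 - 1)))%N.
    rewrite -[X in (_ + X)%N]mul1n -mulnDl rE -uv [in RHS]kE /i.
    by move: (N.*2 - 1)%N (_./2) (_./2) => w s t; clear; lia.
  have -> : (k + r * i + i = (k + v * k * (N.*2 - 1)) * N.*2)%N.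
    by rewrite -addnA riE; move: nE; move: (N.*2 - 1)%N N.*2 => w l ->; clear; lia.
  by rewrite modnMl.
have [|u [v uv]] := inv (r - 1)./2; first by clear -r3; lia.
have Nk : (N %| k)%N.
  have dvd : (N.*2 %| 2 * (k * (r - 1)./2))%N.
    have rE : (r = 2 * (r - 1)./2 + 1)%N by clear -r3; lia.
    have -> : (2 * (k * (r - 1)./2) = r * k - k)%N.
      by rewrite [in RHS]rE mulnDl mul1n addnK -mulnA [(k * _)%N]mulnC.
    by rewrite -eqn_mod_dvd // leq_pmull //; clear -r3; lia.
  rewrite -mul2n dvdn_pmul2l // in dvd.
  have -> : k = (k * (r - 1)./2 * u - k * v * 2 * N)%N by clear -uv; nia.
  by apply: dvdn_sub; [apply: dvdn_mulr | apply: dvdn_mull].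
have [k0|kN] : k = 0%N \/ k = N.
- by case/dvdnP: Nk k_lt => [[|[|j]] ->]; clear -N1; [left | right | nia]; lia.
- by apply: (split_rainbow N1 oa card_gT bH); rewrite bbE k0.
by apply: (quaternion_rainbow N1 oa card_gT bH); rewrite bbE kN.
Qed.

End Families.

Theorem theorem1p1 (gT : finGroupType) (n : nat) :
  ~~ odd n -> (2 < n)%N -> #|gT| = (2 * n)%N ->
  (* dihedral group of order 2n *)
  ([set: gT] \isog Grp (a : b : (a ^+ n, b ^+ 2, a ^ b = a^-1))
   (* dicyclic group of order 4s = 2n, s = n/2 *)
   \/ [set: gT] \isog Grp (a : b : (a ^+ (2 * n./2), b ^+ 2 = a ^+ n./2, a ^ b = a^-1))
   (* abelian, cyclic subgroup of index 2, not a cyclic 2-group *)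
   \/ (abelian [set: gT] /\
       (exists H : {group gT}, cyclic H /\ #|[set: gT] : H| = 2%N) /\
       ~ (cyclic [set: gT] /\ 2.-group [set: gT]))
   (* non-cyclic 2-group with a cyclic subgroup of index 2 *)
   \/ ([/\ 2.-group [set: gT], ~~ cyclic [set: gT] &
        exists H : {group gT}, cyclic H /\ #|[set: gT] : H| = 2])) ->
  exists F : {set {set {set gT}}},
    [/\ one_factorization F, regular_factorization F &
        exists Ts : {set {set {set gT}}}, complete_rainbow_set F Ts].
Proof.
move=> n_even n3 card_n; set N := n./2.
have nE : n = N.*2 by rewrite -[LHS]odd_double_half (negPf n_even).
have N1 : (1 < N)%N by lia.
have card_gT : #|gT| = (2 * N.*2)%N by rewrite card_n nE.
have cyclic_index2 : (exists H : {group gT}, cyclic H /\ #|[set: gT] : H| = 2%N) ->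
    exists a b : gT, #[a] = N.*2 /\ b \notin <[a]>.
  case=> H [/cyclicP[a HE] iH]; have oa : #[a] = N.*2.
    by have := Lagrange (subsetT H); rewrite cardsT card_gT iH HE -orderE; lia.
  exists a; have /subsetPn[b _ bH] : ~~ ([set: gT] \subset <[a]>).
    apply: contraTN isT => /subset_leq_card; rewrite cardsT card_gT -orderE oa; lia.
  by exists b.
case=> [|[|[[abG [/cyclic_index2[a [b [oa bH]]] not_c2]]|[pG ncG /cyclic_index2[a [b [oa bH]]]]]]].
- move/isoGrp_hom/existsP=> [[a b] /= /eqP[genG an bb ab]].
  have [|||oa bH] := extension_order N1 card_gT genG; rewrite ?ab ?bb -?nE ?groupV ?cycle_id ?group1 //.
  exact: (split_rainbow N1 oa card_gT bH).
- move/isoGrp_hom/existsP=> [[a b] /= /eqP[genG an bb ab]].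
  have [|||oa bH] := extension_order N1 card_gT genG; rewrite ?ab ?bb -?mul2n ?groupV ?cycle_id ?mem_cycle //.
  exact: (quaternion_rainbow N1 oa card_gT bH).
- exact: (abelian_rainbow N1 card_gT oa bH).
exact: (two_group_rainbow N1 card_gT oa bH).
Qed.
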